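(* Let $k,n\in\mathbb N$ with $1\le k<n$, let $\lambda\vdash n$ and $x\in\lambda$. Then $$(n-k)\,\Delta_\lambda(k,x)=(n-1)!-\frac{n!\,f_\lambda(k,x)}{f_\lambda}+\sum_{l=1}^{k-1}\Delta_\lambda(l,x),$$ and consequently $$\Delta_\lambda(k,x)=\frac{n!}{(n-k)(n-k+1)}\left(1-\frac{f_\lambda(k,x)}{f_\lambda}(n-k+1)-\sum_{l=1}^{k-1}\frac{f_\lambda(l,x)}{f_\lambda}\right).$$
   Context: A partition $\lambda\vdash n$ is identified with its Young diagram $\{(i,j): i\ge1,\ 1\le j\le\lambda_i\}$. A tabloid is a bijection $T:\lambda\to\{1,\dots,n\}$; $\operatorname{T}(\lambda)$ is the set of tabloids. A standard Young tableau is a tabloid whose entries increase along rows and down columns; $f_\lambda$ is the number of standard Young tableaux of shape $\lambda$ and $f_\lambda(k,x)$ the number of those with entry $k$ in cell $x$. $N^-_\lambda(x)$ denotes the set of top and left neighbours $\{(i-1,j),(i,j-1)\}\cap\lambda$ of $x=(i,j)$, and $N^+_\lambda(x)=\{(i,j+1),(i+1,j)\}\cap\lambda$ the right and bottom neighbours. Order cells by $(i,j)\prec(k,l)$ iff $j<l$, or $j=l$ and $i<k$; list them $z_1\prec\dots\prec z_n$. Novelli--Pak--Stoyanovskii sorting of $T$: $T_{z_n}:=T$; for $m=n-1,\dots,1$, $T_{z_m}$ is obtained from $T_{z_{m+1}}$ by the slide at $z_m$: the entry in $z_m$ is repeatedly exchanged with the smaller of the entries in its current right and bottom neighbours as long as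 that entry is smaller than it. Local exchange numbers: for $1\le k<n$ and cells $x,y$, $\varepsilon_\lambda(k,x,y)$ is the number of $T\in\operatorname{T}(\lambda)$ such that for some $m$, $T(z_m)=n$, $T_{z_{m+1}}(x)=k$ and $T_{z_m}(y)=k$ (i.e. the slide of the entry $n$ moves $k$ from $x$ to $y$). Signed exit numbers: $\Delta_\lambda(k,x):=\sum_{y\in N^-_\lambda(x)}\varepsilon_\lambda(k,x,y)-\sum_{y\in N^+_\lambda(x)}\varepsilon_\lambda(k,y,x)$. *)

(* Defs.v *)
From HB Require Import structures.
From mathcomp Require Import all_boot all_order all_algebra all_fingroup.
Set Implicit Arguments. Unset Strict Implicit. Unset Printing Implicit Defensive.
Import Order.TTheory GRing.Theory Num.Theory.

Definition is_partition (la : seq nat) (n : nat) : bool :=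
  sorted geq la && all (fun p => 0 < p) la && (sumn la == n).

(* Cells are 1-based pairs (i, j): row i, column j. *)
Definition cell := (nat * nat)%type.

Definition in_diagram (la : seq nat) (c : cell) : bool :=
  (0 < c.1 <= size la) && (0 < c.2 <= nth 0 la c.1.-1).

Definition cells (la : seq nat) : seq cell :=
  flatten [seq [seq (i, j) | i <- iota 1 (size la) & j <= nth 0 la i.-1]
          | j <- iota 1 (head 0 la)].

Definition zcell (la : seq nat) (m : nat) : cell := nth (0, 0) (cells la) m.-1.

(* A filling of cells by natural numbers (only the values on the diagram matter). *)
Definition filling := cell -> nat.

(* Tabloids (bijections la -> {1..n}) are encoded by permutations s of 'I_n:
   the tabloid tab_of la s puts the entry (s (m-1)) + 1 into cell z_m. *)
Definition tab_of (n : nat) (la : seq nat) (s : {perm 'I_n}) : filling :=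
  fun c => nth 0 [seq (s i).+1 | i <- enum 'I_n] (index c (cells la)).

Definition is_standard (la : seq nat) (T : filling) : bool :=
  all (fun c => ((in_diagram la (c.1, c.2.+1)) ==> (T c < T (c.1, c.2.+1))) &&
                ((in_diagram la (c.1.+1, c.2)) ==> (T c < T (c.1.+1, c.2))))
      (cells la).

Definition f_la (n : nat) (la : seq nat) : nat :=
  #|[set s : {perm 'I_n} | is_standard la (tab_of la s)]|.

Definition f_la_at (n : nat) (la : seq nat) (k : nat) (x : cell) : nat :=
  #|[set s : {perm 'I_n} | is_standard la (tab_of la s) && (tab_of la s x == k)]|.

Definition swapf (T : filling) (p q : cell) : filling :=
  fun c => if c == p then T q else if c == q then T p else T c.

Fixpoint slide_go (fuel : nat) (la : seq nat) (T : filling) (p : cell) : filling :=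
  match fuel with
  | 0 => T
  | f.+1 =>
    let r := (p.1, p.2.+1) in
    let b := (p.1.+1, p.2) in
    let oq :=
      match in_diagram la r, in_diagram la b with
      | true, true => Some (if T r < T b then r else b)
      | true, false => Some r
      | false, true => Some b
      | false, false => None
      end in
    match oq with
    | Some q => if T q < T p then slide_go f la (swapf T p q) q else T
    | None => T
    end
  end.

(* Each step increases i + j, so sumn la steps always suffice. *)
Definition slide (la : seq nat) (T : filling) (p : cell) : filling :=
  slide_go (sumn la) la T p.

(* nps_aux la T d = T_{z_{n-d}}, where T_{z_n} = T. *)
Fixpoint nps_aux (n : nat) (la : seq nat) (T : filling) (d : nat) : filling :=
  match d with
  | 0 => T
  | d'.+1 => slide la (nps_aux n la T d') (zcell la (n - d))
  end.

Definition Tz (n : nat) (la : seq nat) (T : filling) (m : nat) : filling :=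
  nps_aux n la T (n - m).

Definition eps (n : nat) (la : seq nat) (k : nat) (x y : cell) : nat :=
  #|[set s : {perm 'I_n} |
     [exists m : 'I_n,
       (0 < (m : nat)) &&
       (tab_of la s (zcell la m) == n) &&
       (Tz n la (tab_of la s) m.+1 x == k) &&
       (Tz n la (tab_of la s) m y == k)]]|.

Definition Nminus (la : seq nat) (x : cell) : seq cell :=
  [seq y <- [:: (x.1.-1, x.2); (x.1, x.2.-1)] | in_diagram la y].

Definition Nplus (la : seq nat) (x : cell) : seq cell :=
  [seq y <- [:: (x.1, x.2.+1); (x.1.+1, x.2)] | in_diagram la y].

Local Open Scope ring_scope.

Definition Delta (n : nat) (la : seq nat) (k : nat) (x : cell) : rat :=
  \sum_(y <- Nminus la x) (eps n la k x y)%:R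
  - \sum_(y <- Nplus la x) (eps n la k y x)%:R.

(* Main.v *)
(* In the slide at a cell [z], an entry [k] smaller than the entry [a] of [z]
   moves in a way that depends on [a] only through [k < a]: exchanging the
   values [a] and [a + 1] either commutes with the slide or is undone by it.
   Hence each [a > k] contributes as much to the flow of [k] out of [x] as
   [a = n] does, which gives [(n - k) Delta(k, x)] in total.  Entries do not
   move in the slides of smaller ones, and when [k] itself slides it moves
   against the smaller entries, which gives [- \sum_(l < k) Delta(l, x)].  The
   total flow of [k] out of [x] is the number of tabloids with [k] in [x]
   before the sorting, [(n - 1)!], minus the number of those with [k] in [x]
   after it.

   The latter is [n! f(k, x) / f], because every standard tableau is the result
   of the same number of tabloids (Novelli, Pak, Stoyanovskii).  This is shown
   column by column: while column [j] is sorted, one records for each slide its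
   end cell, each earlier end cell in a row passed by the slide being shifted
   diagonally up-left.  From the recorded cells and the current tableau, the
   last slide is recovered as the rightmost of the reverse paths starting from
   these cells; the records that occur are exactly those for which all reverse
   paths end at the cell last treated, and once the column is complete this
   condition is void. *)
Require Import Defs.
From HB Require Import structures.
From mathcomp Require Import all_boot all_order all_algebra all_fingroup.
From mathcomp Require Import zify ring.
From Stdlib Require Import FunctionalExtensionality.
Set Implicit Arguments. Unset Strict Implicit. Unset Printing Implicit Defensive.

(** * Diagrams, tabloids and slides *)

Section Diagram.
Variables (la : seq nat) (n : nat).
Hypothesis part : is_partition la n.
Local Notation dg := (in_diagram la).

Lemma in_diagramP a b :
  reflect [/\ 0 < a, a <= size la, 0 < b & b <= nth 0 la a.-1] (dg (a, b)).
Proof. by apply: (iffP andP) => /= [[/andP[-> ->] /andP[-> ->]]|[-> -> -> ->]]. Qed.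

Lemma nth_partition a b : a <= b -> nth 0 la b <= nth 0 la a.
Proof.
case/andP: part => /andP[srt _] _ le_ab.
have [lb|lb] := ltnP b (size la); last by rewrite (nth_default _ lb).
have tr : transitive geq by move=> x y z /= h1 h2; apply: leq_trans h2 h1.
have rf : reflexive geq by move=> x /=.
apply: (sorted_leq_nth tr rf 0 srt) => //; rewrite inE //.
exact: leq_ltn_trans lb.
Qed.

Lemma in_diagram_sub a b a' b' :
  dg (a, b) -> 0 < a' <= a -> 0 < b' <= b -> dg (a', b').
Proof.
move=> /in_diagramP[a0 al b0 bl] /andP[a'0 la'] /andP[b'0 lb'].
apply/in_diagramP; split=> //; first exact: leq_trans al.
apply: leq_trans lb' _; apply: leq_trans bl _; apply: nth_partition; lia.
Qed.

Lemma in_diagram_gt0 a b : dg (a, b) -> (0 < a) && (0 < b).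
Proof. by case/in_diagramP=> -> _ ->. Qed.

(** Every row other than row [a] has at least one cell. The bound shows that the fuel of a slide
    suffices and that codes have bounded entries. *)
Lemma in_diagram_bound a b : dg (a, b) -> a + b <= n.+1.
Proof.
case/andP: part => /andP[_ pos] /eqP sm /in_diagramP[a0 al b0 bl].
have gen (s : seq nat) i : all (fun p => 0 < p) s -> i < size s ->
    nth 0 s i + size s <= (sumn s).+1.
  elim: s i => // y s IH [|i] /= /andP[y0 ps] ls.
    have : size s <= sumn s.
      by elim: s ps {IH ls} => //= z s IH /andP[z0 /IH]; lia.
    by lia.
  by have := IH i ps ls; lia.
by have := gen la a.-1 pos; rewrite sm; lia.
Qed.

Definition col_height j := count (fun i => j <= nth 0 la i.-1) (iota 1 (size la)).

Lemma filter_iota_down (p : pred nat) m s :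
  (forall a b, a <= b -> p b -> p a) ->
  [seq i <- iota m s | p i] = iota m (count p (iota m s)).
Proof.
move=> dn; elim: s m => //= s IH m; case: ifP => pm; first by rewrite IH.
have H i : i \in iota m.+1 s -> ~~ p i.
  rewrite mem_iota => /andP[mi _]; apply/negP => /(dn m i (ltnW mi)); by rewrite pm.
have -> : count p (iota m.+1 s) = 0.
  by apply/eqP; rewrite -leqn0 leqNgt -has_count; apply/hasPn.
by apply/eqP; rewrite -[_ == _]negbK -has_filter; apply/hasPn.
Qed.

Lemma col_iota j :
  [seq i <- iota 1 (size la) | j <= nth 0 la i.-1] = iota 1 (col_height j).
Proof.
apply: filter_iota_down => a b ab h; apply: leq_trans h _; apply: nth_partition;
  lia.
Qed.

Lemma in_diagram_height a j : 0 < j -> dg (a, j) = (0 < a <= col_height j).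
Proof.
move=> j0; have := mem_filter (fun i => j <= nth 0 la i.-1) a (iota 1 (size la)).
rewrite col_iota !mem_iota add1n ltnS => ->; rewrite /in_diagram /= j0 /=.
by rewrite add1n ltnS andbC.
Qed.

Definition col_cells i j : seq cell := [seq (h,
  j) | h <- iota i ((col_height j).+1 - i)].

Lemma cellsE : cells la = flatten [seq col_cells 1 j | j <- iota 1 (head 0 la)].
Proof.
rewrite /cells; congr flatten; apply: eq_map => j.
by rewrite /col_cells subSS subn0 -col_iota.
Qed.

Lemma mem_cells c : (c \in cells la) = dg c.
Proof.
case: c => a b; apply/idP/idP.
  rewrite cellsE => /flatten_mapP[j]; rewrite mem_iota => /andP[j1 _].
  case/mapP=> h; rewrite mem_iota => hh [-> ->].
  by rewrite in_diagram_height //; lia.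
move=> D; rewrite cellsE; apply/flatten_mapP; exists b.
  have /in_diagramP[_ al _ bl] := D; case/andP: (in_diagram_gt0 D) => a0 b0.
  rewrite mem_iota b0 /= add1n ltnS -nth0; apply: leq_trans bl _.
  exact: nth_partition.
case/andP: (in_diagram_gt0 D) => a0 b0; move: D; rewrite in_diagram_height // => D.
by apply/mapP; exists a => //; rewrite mem_iota; lia.
Qed.

Lemma uniq_cells : uniq (cells la).
Proof.
rewrite cellsE.
elim: (head 0 la) {2}1 => //= m IH j.
rewrite cat_uniq IH andbT; apply/andP; split.
  by rewrite map_inj_uniq ?iota_uniq // => x y [].
apply/hasPn=> -[a b] /flatten_mapP[j']; rewrite mem_iota => /andP[jj _].
case/mapP=> h _ [-> ->]; apply/mapP=> -[h' _ [_ E]]; lia.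
Qed.

Lemma size_cells : size (cells la) = n.
Proof.
(* The same cells listed row by row; the length of this list is the sum of the parts. *)
pose rows := flatten [seq [seq (i, j) | j <- iota 1 (nth 0 la i.-1)]
                     | i <- iota 1 (size la)].
have mr c : (c \in rows) = dg c.
  case: c => a b; apply/idP/idP.
    move=> /flatten_mapP[i]; rewrite mem_iota => hi.
    by case/mapP=> h; rewrite mem_iota => hh [-> ->]; apply/in_diagramP; split; lia.
  move=> /in_diagramP[h1 h2 h3 h4]; apply/flatten_mapP; exists a.
    by rewrite mem_iota; lia.
  by apply/mapP; exists b => //; rewrite mem_iota; lia.
have ur : uniq rows.
  rewrite /rows.
  elim: (size la) {2}1 => //= m IH j.
  rewrite cat_uniq IH andbT; apply/andP; split.
    by rewrite map_inj_uniq ?iota_uniq // => x y [].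
  apply/hasPn=> -[a b] /flatten_mapP[j']; rewrite mem_iota => /andP[jj _].
  case/mapP=> h _ [-> ->]; apply/mapP=> -[h' _ [E]]; lia.
have /perm_size -> : perm_eq (cells la) rows.
  by apply: uniq_perm uniq_cells ur _ => c; rewrite mem_cells mr.
case/andP: part => _ /eqP <-; rewrite /rows size_flatten /shape -map_comp.
congr sumn; apply: (@eq_from_nth _ 0); first by rewrite size_map size_iota.
move=> i; rewrite size_map size_iota => li.
by rewrite (nth_map 0) ?size_iota //= nth_iota // size_map size_iota.
Qed.

End Diagram.

Section Next.
Variable la : seq nat.
Local Notation dg := (in_diagram la).

Definition adj (c c' : cell) : bool := (c' == (c.1, c.2.+1)) || (c' == (c.1.+1,
  c.2)).

Lemma adj_neq c c' : adj c c' -> (c == c') = false.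
Proof. by case: c c' => a b [a' b'] /orP[]/eqP[-> ->]; apply/eqP => -[]; lia. Qed.

(** The choice made inside [slide_go], isolated so that one step unfolds by computation in
    [slide_goS]. *)
Definition slide_target (T : filling) (p : cell) : option cell :=
  match dg (p.1, p.2.+1), dg (p.1.+1, p.2) with
  | true, true => Some (if T (p.1, p.2.+1) < T (p.1.+1, p.2)
                        then (p.1, p.2.+1) else (p.1.+1, p.2))
  | true, false => Some (p.1, p.2.+1)
  | false, true => Some (p.1.+1, p.2)
  | false, false => None
  end.

Lemma slide_goS f T p : slide_go f.+1 la T p =
  if slide_target T p is Some q then
    if T q < T p then slide_go f la (swapf T p q) q else T
  else T.
Proof. by []. Qed.

Variant slide_target_spec (T : filling) (p : cell) : option cell -> Prop :=
| NoTarget : (forall q, adj p q -> ~~ dg q) -> slide_target_spec T p None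
| Target q : adj p q -> dg q -> (forall q', adj p q' -> dg q' -> T q <= T q') ->
    slide_target_spec T p (Some q).

Lemma slide_targetP T p : slide_target_spec T p (slide_target T p).
Proof.
rewrite /slide_target; case D1: (dg (p.1, p.2.+1)); case D2: (dg (p.1.+1, p.2)).
- case: ifP => H; constructor;
  rewrite /adj ?eqxx ?orbT // => q' /orP[]/eqP-> _ //; lia.
- by constructor; rewrite /adj ?eqxx ?orbT // => q' /orP[]/eqP-> //; rewrite D2.
- by constructor; rewrite /adj ?eqxx ?orbT // => q' /orP[]/eqP-> //; rewrite D1.
- by constructor => q /orP[]/eqP->; rewrite ?D1 ?D2.
Qed.

End Next.

Section Tabloids.
Variables (la : seq nat) (n : nat).
Hypothesis part : is_partition la n.
Local Notation dg := (in_diagram la).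

Lemma cell_ix c : dg c -> exists i : 'I_n, c = nth (0, 0) (cells la) i.
Proof.
rewrite -(mem_cells part) => cc.
have lc : index c (cells la) < n by rewrite -[X in _ < X](size_cells part)
  index_mem.
by exists (Ordinal lc); rewrite /= nth_index.
Qed.

Lemma tab_nth (s : {perm 'I_n}) (i : 'I_n) :
  tab_of la s (nth (0, 0) (cells la) i) = (s i).+1.
Proof.
rewrite /tab_of index_uniq ?(size_cells part) ?(uniq_cells part) //.
rewrite (nth_map i) ?size_enum_ord //.
by rewrite nth_ord_enum.
Qed.

Lemma tab_out (s : {perm 'I_n}) c : ~~ dg c -> tab_of la s c = 0.
Proof.
rewrite -(mem_cells part) => nc; rewrite /tab_of nth_default //.
by rewrite size_map size_enum_ord -[X in X <= _](size_cells part) leqNgt index_mem.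
Qed.

Definition inj_on (T : filling) := forall c c',
  dg c -> dg c' -> T c = T c' -> c = c'.

Lemma tab_inj (s : {perm 'I_n}) : inj_on (tab_of la s).
Proof.
move=> c c' /cell_ix[i ->] /cell_ix[i' ->]; rewrite !tab_nth.
by move=> [/val_inj/perm_inj ->].
Qed.

Lemma tab_range (s : {perm 'I_n}) c : dg c -> 0 < tab_of la s c <= n.
Proof. by move=> /cell_ix[i ->]; rewrite tab_nth ltn_ord. Qed.

Lemma tab_surj (s : {perm 'I_n}) k : 0 < k <= n -> exists2 c,
  dg c & tab_of la s c = k.
Proof.
case: k => // k /= kn; exists (nth (0, 0) (cells la) ((s^-1)%g (Ordinal kn))).
  by rewrite -(mem_cells part) mem_nth // (size_cells part).
by rewrite tab_nth permKV.
Qed.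

Lemma tab_of_inj : injective (@tab_of n la).
Proof.
move=> s t E; apply/permP=> i; apply/val_inj.
by have := f_equal (fun T => T (nth (0, 0) (cells la) i)) E;
  rewrite !tab_nth => -[].
Qed.

Lemma tab_eq (s t : {perm 'I_n}) :
  (forall c, dg c -> tab_of la s c = tab_of la t c) -> s = t.
Proof.
move=> E; apply: tab_of_inj; apply: functional_extensionality => c.
have [D|D] := boolP (dg c); [exact: E | by rewrite !tab_out].
Qed.

(** Exchanging two cells composes the permutation with a transposition of their indices, so slides
    stay within the encoding. *)
Lemma tab_swap (s : {perm 'I_n}) p q : dg p -> dg q ->
  exists s' : {perm 'I_n}, swapf (tab_of la s) p q = tab_of la s'.
Proof.
move=> dp dq; have [i Ei] := cell_ix dp; have [i' Ei'] := cell_ix dq.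
have nth_eq (a b : 'I_n) :
    (nth (0, 0) (cells la) a == nth (0, 0) (cells la) b) = (a == b).
  by rewrite nth_uniq ?(size_cells part) // (uniq_cells part).
exists (tperm i i' * s)%g; apply: functional_extensionality => c.
have [D|D] := boolP (dg c); last first.
  rewrite /swapf !(tab_out _ D).
  by case: eqP => [E|_]; [rewrite E dp in D | case: eqP => // E; rewrite E dq in D].
have [x ->] := cell_ix D; rewrite /swapf Ei Ei' !tab_nth !nth_eq permM.
case: tpermP => [->|->|/eqP/negPf -> /eqP/negPf ->] //; rewrite eqxx //.
by case: eqP => [->|].
Qed.

Lemma slide_go_tab f (s : {perm 'I_n}) p : dg p ->
  exists s' : {perm 'I_n}, slide_go f la (tab_of la s) p = tab_of la s'.
Proof.
elim: f s p => [|f IH] s p dp; first by exists s.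
rewrite slide_goS; case: slide_targetP => [_|q _ dq _]; first by exists s.
case: ifP => _; last by exists s.
by have [s' ->] := tab_swap s dp dq; apply: IH.
Qed.

End Tabloids.

(** * Order restored by one slide *)

Section Sift.
Variables (la : seq nat) (n : nat).
Hypothesis part : is_partition la n.
Local Notation dg := (in_diagram la).
Variable j : nat.

(* The cells not preceding [(i, j)] in the order of the sorting procedure. *)
Definition region (i : nat) (c : cell) : bool :=
  dg c && ((j < c.2) || ((c.2 == j) && (i <= c.1))).

Definition std_from (i : nat) (T : filling) : Prop :=
  forall c c', region i c -> dg c' -> adj c c' -> T c < T c'.

Lemma region_in_diagram i c : region i c -> dg c. Proof. by case/andP. Qed.

Lemma region_adj i c c' : region i c -> dg c' -> adj c c' -> region i c'.
Proof.
case: c c' => a b [a' b'] /andP[_ /= h] d /orP[]/eqP[E1 E2];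
by rewrite /region d /= E1 E2 /=; lia.
Qed.

Lemma swapf_inj_on T p q : dg p -> dg q -> inj_on la T -> inj_on la (swapf T p q).
Proof.
move=> dp dq inj c c' dc dc'.
pose t x := if x == p then q else if x == q then p else x.
have tE x : swapf T p q x = T (t x) by rewrite /swapf /t; do 2![case: eqP => // _].
have dt x : dg x -> dg (t x) by rewrite /t; do 2![case: eqP => // _].
have tK x : t (t x) = x.
  rewrite /t; case: (eqVneq x p) => [->|n1]; first by rewrite eqxx; case: eqP.
  by case: (eqVneq x q) => [->|n2]; [rewrite eqxx | rewrite (negPf n1) (negPf n2)].
by rewrite !tE => /inj E; rewrite -(tK c) E ?dt // tK.
Qed.

(** Invariant: order can fail only between [p] and its right and bottom neighbours, and the top and
    left neighbours of [p] are already below these. An exchange keeps this with [q] for [p]. It also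
    raises the coordinate sum, which [in_diagram_bound] limits, so the fuel cannot run out. *)
Lemma slide_go_std i f T p : inj_on la T -> region i p -> n.+2 <= p.1 + p.2 + f ->
  (forall c c', region i c -> dg c' -> adj c c' -> c != p -> T c < T c') ->
  (forall c c', region i c -> adj c p -> dg c' -> adj p c' -> T c < T c') ->
  std_from i (slide_go f la T p).
Proof.
elim: f T p => [|f IH] T p inj rp hf I1 I2.
  case: p rp hf {I1 I2} => a b rp /= hf.
  by have := in_diagram_bound part (region_in_diagram rp); lia.
rewrite slide_goS; case: (slide_targetP la T p) => [N|q pq dq qmin].
  move=> c c' rc dc' cc'; apply: I1 => //.
  by apply/eqP => E; move: (N c'); rewrite -E cc' dc' => /(_ isT).
case: ifP => lt_qp; last first.
  move=> c c' rc dc' cc'; have [E|ne] := eqVneq c p; last exact: I1.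
  rewrite E in cc' *; have := qmin _ cc' dc';
    rewrite leq_eqVlt => /orP[/eqP E2|]; last first.
    by move: lt_qp; lia.
  have := inj _ _ dq dc' E2 => E3; rewrite -E3.
  have : T p != T q by apply/eqP => /(inj _ _ (region_in_diagram rp) dq) E4;
    move: (adj_neq pq); rewrite -E4 eqxx.
  lia.
have dp := region_in_diagram rp; have rq := region_adj rp dq pq.
have npq := adj_neq pq.
have minq c' : adj p c' -> dg c' -> c' != q -> T q < T c'.
  move=> h1 h2 h3; have := qmin _ h1 h2; rewrite leq_eqVlt => /orP[/eqP/inj E|//].
  by rewrite E ?eqxx // in h3.
have T1p : swapf T p q p = T q by rewrite /swapf eqxx.
have T1q : swapf T p q q = T p by rewrite /swapf eq_sym npq eqxx.
have T1o c : c != p -> c != q -> swapf T p q c = T c.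
  by rewrite /swapf => /negPf-> /negPf->.
apply: IH => //; first exact: swapf_inj_on.
- by case: p q pq {rp dp T1p lt_qp I1 I2 qmin dq rq npq minq T1q T1o} hf =>
  a b [a' b'] /orP[]/eqP[-> ->] /=; lia.
- move=> c c' rc dc' cc' nc; have [Ec|ncp] := eqVneq c p.
    rewrite Ec T1p in cc' *; have [->|nq] := eqVneq c' q; first by rewrite T1q.
    by rewrite T1o ?minq // eq_sym adj_neq.
  rewrite (T1o c) //; have [Ec'|nc'p] := eqVneq c' p.
    by rewrite Ec' T1p in cc' *; apply: I2.
  have [Ec'|nc'q] := eqVneq c' q; last by rewrite T1o //; apply: I1.
  rewrite Ec' T1q in cc' *; apply: ltn_trans lt_qp; exact: I1.
- move=> c c' rc cq dc' qc'.
  have nc'p : c' != p.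
    by apply/eqP => E; case: p q c' pq qc' E {I1 I2 rp dp lt_qp npq hf qmin dq rq
      minq T1p T1q T1o cq dc'} =>
        a b [a' b'] [a'' b''] /orP[]/eqP[-> ->] /orP[]/eqP[-> ->] []; lia.
  have nc'q : c' != q by rewrite eq_sym adj_neq.
  have nq : q != p by rewrite eq_sym npq.
  rewrite (T1o c') //; have h : T q < T c' by apply: I1.
  have [Ec|nc] := eqVneq c p; first by rewrite Ec T1p.
  rewrite T1o //; last by rewrite adj_neq.
  by apply: ltn_trans h; apply: I1.
Qed.

End Sift.

(** * Undoing a slide along its path *)

Section Unslide.

(** A path going right and down from [(lo, d lo)] to [(hi, d hi.+1)]: in row [a] it covers the
    columns [d a] to [d a.+1], then it descends in column [d a.+1]. *)
Definition on_path (d : nat -> nat) lo hi (c : cell) : bool :=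
  (lo <= c.1 <= hi) && (d c.1 <= c.2 <= d c.1.+1).

Definition path_ok (d : nat -> nat) lo hi : Prop :=
  lo <= hi /\ forall a, lo <= a <= hi -> d a <= d a.+1.

Lemma path_mono d lo hi a b : path_ok d lo hi -> lo <= a -> a <= b -> b <= hi.+1 ->
  d a <= d b.
Proof.
move=> [_ mono] la_; elim: b => [|b IH] ab bh; first by have -> : a = 0 by lia.
move: ab; rewrite leq_eqVlt => /orP[/eqP->//|ab].
by apply: leq_trans (IH _ _) (mono _ _); lia.
Qed.

(** Reverses a slide along the path: the entry at the end returns to the start, and every other path
    cell takes back the entry of its predecessor. *)
Definition unslide (d : nat -> nat) lo hi (S : filling) : filling := fun c =>
  if c == (lo, d lo) then S (hi, d hi.+1)
  else if on_path d lo hi c then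
    if d c.1 < c.2 then S (c.1, c.2.-1) else S (c.1.-1, c.2)
  else S c.

Lemma unslide_ext d d' lo hi S : lo <= hi -> (forall a,
  lo <= a <= hi.+1 -> d a = d' a) ->
  unslide d lo hi S = unslide d' lo hi S.
Proof.
move=> lh E; apply: functional_extensionality => -[x y].
rewrite /unslide /on_path /= (E lo) ?(E hi.+1); try lia.
case: (boolP (lo <= x <= hi)) => h //=; rewrite (E x) ?(E x.+1) //; lia.
Qed.

Lemma unslide_off d lo hi S c : lo <= hi -> d lo <= d lo.+1 ->
  ~~ on_path d lo hi c -> unslide d lo hi S c = S c.
Proof.
move=> lh l1 H; rewrite /unslide (negPf H); case: eqP => // E.
by move: H; rewrite E /on_path /=; lia.
Qed.

Lemma unslide_start d lo hi S : unslide d lo hi S (lo, d lo) = S (hi, d hi.+1).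
Proof. by rewrite /unslide eqxx. Qed.

Lemma unslide_row d lo hi S a b : lo <= a <= hi -> d a < b <= d a.+1 ->
  unslide d lo hi S (a, b) = S (a, b.-1).
Proof.
move=> h1 h2; rewrite /unslide /on_path xpair_eqE /=.
have -> : (a == lo) && (b == d lo) = false by apply/negP => /andP[/eqP E /eqP];
  subst a; lia.
by have -> : (lo <= a <= hi) && (d a <= b <= d a.+1);
  [lia | have -> : d a < b by lia].
Qed.

Lemma unslide_col d lo hi S a : path_ok d lo hi -> lo < a <= hi ->
  unslide d lo hi S (a, d a) = S (a.-1, d a).
Proof.
move=> [_ mono] h1; rewrite /unslide /on_path xpair_eqE /= ltnn leqnn /=.
have -> : (a == lo) = false by lia.
by rewrite mono /=; [have -> : lo <= a <= hi by lia|lia].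
Qed.

Ltac ucase S := repeat (case: ifP => ?); first [lia | done | congr (S (_, _)); lia].

(** Splitting off the first step of the path as an exchange, here and in [unslide_down], mirrors the
    recursion of [slide_go]. *)
Lemma unslide_right d lo hi S : path_ok d lo hi -> d lo < d lo.+1 ->
  unslide d lo hi S =
  swapf (unslide (fun x => if x == lo then (d lo).+1 else d x) lo hi S)
    (lo, d lo) (lo, (d lo).+1).
Proof.
move=> [lh mono] lt1; apply: functional_extensionality => -[x y].
rewrite /swapf /unslide /on_path !xpair_eqE /= !eqxx /= ?andbT.
have [->|nx] /= := eqVneq x lo.
  rewrite ?eqxx /=.
  have -> : (lo.+1 == lo) = false by lia.
  have -> : (hi.+1 == lo) = false by lia.
  by ucase S.
case: (boolP (lo <= x <= hi)) => h //=.
by have -> : (x.+1 == lo) = false by lia.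
Qed.

Lemma unslide_down d lo hi S : path_ok d lo hi -> d lo = d lo.+1 -> lo < hi ->
  unslide d lo hi S =
  swapf (unslide d lo.+1 hi S) (lo, d lo) (lo.+1, d lo).
Proof.
move=> [lh mono] E lt1; apply: functional_extensionality => -[x y].
have m1 := mono lo.+1.
rewrite /swapf /unslide /on_path !xpair_eqE /= -E !eqxx /= ?andbT.
have -> : (lo == lo.+1) = false by lia.
have [->|nx] /= := eqVneq x lo.
  rewrite -E; have -> : (lo == lo.+1) = false by lia.
  by ucase S.
have [->|nx'] /= := eqVneq x lo.+1.
  by rewrite -E; ucase S.
by have -> : (lo <= x <= hi) = (lo < x <= hi) by lia.
Qed.

Lemma unslide_end d lo S : d lo = d lo.+1 -> unslide d lo lo S = S.
Proof.
move=> E; apply: functional_extensionality => -[x y].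
rewrite /unslide /on_path !xpair_eqE /= -E.
case: eqP => [->|nx] /=; first by rewrite -E; ucase S.
by have -> : (lo <= x <= lo) = false by lia.
Qed.

End Unslide.

Section SlidePath.
Variables (la : seq nat).
Local Notation dg := (in_diagram la).

Lemma swapfK T p q : swapf (swapf T p q) p q = T.
Proof.
apply: functional_extensionality => c; rewrite /swapf !eqxx.
case: (eqVneq c p) => [->|n1]; first by case: (eqVneq q p) => [->|].
by case: (eqVneq c q) => [->|].
Qed.

(** The path is built along the recursion: each exchange puts one cell in front of the path of the
    remaining slide. *)
Lemma slide_path f T a b : dg (a, b) ->
  exists hi d, [/\ path_ok d a hi, d a = b, dg (hi, d hi.+1) &
    T = unslide d a hi (slide_go f la T (a, b))].
Proof.
have stop T0 a0 b0 : dg (a0, b0) -> exists hi d,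
    [/\ path_ok d a0 hi, d a0 = b0, dg (hi, d hi.+1) & T0 = unslide d a0 hi T0].
  move=> d0; exists a0, (fun=> b0); split=> //.
  by rewrite unslide_end.
elim: f T a b => [|f IH] T a b dab; first exact: stop.
rewrite slide_goS; case: slide_targetP => [_|[a' b'] pq dq _]; first exact: stop.
case: ifP => _; last exact: stop.
have [hi [d [[ah mono] da dhi E]]] := IH (swapf T (a, b) (a', b')) _ _ dq.
have [[E1 E2]|[E1 E2]] : (a' = a /\ b' = b.+1) \/ (a' = a.+1 /\ b' = b).
    by case/orP: pq => /eqP [-> ->]; [left | right].
  all: rewrite E1 E2 in ah mono da dhi dq E *; clear E1 E2 pq;
    set S := slide_go _ _ _ _ in E *.
(* Exchange to the right: the remaining path starts at [(a, b.+1)], and lowering [d a] to [b]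
   prepends the cell. *)
- exists hi, (fun x => if x == a then b else d x); split.
  + split=> // x hx; have hm := mono x hx; have -> : (x.+1 == a) = false by lia.
    by case: eqP => // Ex; subst x; lia.
  + by rewrite eqxx.
  + by have -> : (hi.+1 == a) = false by lia.
  + rewrite unslide_right /= ?eqxx.
    * rewrite (@unslide_ext _ d) // -?E ?swapfK // => x hx.
      by rewrite -da; case: eqP => // ->.
    * split=> // x hx; have hm := mono x hx; have -> : (x.+1 == a) = false by lia.
      by case: eqP => // Ex; subst x; lia.
    * have -> : (a.+1 == a) = false by lia.
      by have := mono a; lia.
(* Exchange downwards: the path gets a new first row [a] that consists of column [b] alone. *)
- pose d' (x : nat) : nat := if x == a then b else d x.
  have d'E x : a < x -> d' x = d x by rewrite /d'; case: eqP; lia.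
  have d'a : d' a = b by rewrite /d' eqxx.
  clearbody d'.
  have ok : path_ok d' a hi.
    split=> [|x hx]; first by lia.
    rewrite (d'E x.+1) ?ltnS; last by lia.
    have [->|ne] := eqVneq x a; first by rewrite d'a da.
    by rewrite d'E; [apply: mono; lia|lia].
  exists hi, d'; split=> //; first by rewrite d'E //; lia.
  rewrite unslide_down //.
  + rewrite (@unslide_ext d' d) // => [|x hx].
      by rewrite -E d'a swapfK.
    by apply: d'E; lia.
  + by rewrite (d'E a.+1) // d'a da.
Qed.

End SlidePath.

(** * Reverse paths *)

Section ReversePaths.
Variables (la : seq nat) (j : nat).
Local Notation dg := (in_diagram la).
Local Notation reg := (region la j).

(** The reverse path moves to the larger of the left and top neighbours, as far as these lie in the
    region; this is the inverse of the choice made by a slide. *)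
Definition go_left i (S : filling) a b : bool :=
  reg i (a, b.-1) && (reg i (a.-1, b) ==> (S (a.-1, b) < S (a, b.-1))).

(* The reverse path arriving at [(a, b)] leaves row [a] upwards in column
   [row_exit i S a b]. *)
Fixpoint row_exit i S a b : nat :=
  if b is b'.+1 then if go_left i S a b then row_exit i S a b' else b else 0.

(* The column in which the reverse path from [(lo + k, b)] enters row [lo]. *)
Fixpoint crossing i S lo k b : nat :=
  if k is k'.+1 then crossing i S lo k' (row_exit i S (lo + k) b) else b.

Lemma row_exit_le i S a b : row_exit i S a b <= b.
Proof. by elim: b => //= b IH; case: ifP => // _; apply: leqW. Qed.

Lemma row_exit_stop i S a b y : ~~ go_left i S a y -> y <= b ->
  y <= row_exit i S a b.
Proof.
move=> ng; elim: b => [|b IH] //= yb; case: ifP => // g; apply: IH.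
by move: yb; rewrite leq_eqVlt => /orP[/eqP E|//]; move: ng; rewrite E g.
Qed.

Lemma row_exit_go_left i S a b y : row_exit i S a b < y <= b -> go_left i S a y.
Proof.
move=> h; apply/negPn/negP => ng; have := row_exit_stop ng (b := b); lia.
Qed.

Lemma row_exit_skip i S a b y : y <= b -> (forall z,
  y < z <= b -> go_left i S a z) ->
  row_exit i S a b = row_exit i S a y.
Proof.
elim: b => [|b IH] yb H; first by move: yb; rewrite leqn0 => /eqP->.
move: yb; rewrite leq_eqVlt => /orP[/eqP->//|yb] /=.
by rewrite H ?IH //; [move=> z hz; apply: H; lia | lia].
Qed.

Lemma row_exit_stopped i S a b : 0 < row_exit i S a b ->
  ~~ go_left i S a (row_exit i S a b).
Proof. by elim: b => //= b IH; case: ifP => // /negbT. Qed.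

Lemma row_exit_mono i S a b b' : b <= b' -> row_exit i S a b <= row_exit i S a b'.
Proof.
elim: b' => [|b' IH]; first by rewrite leqn0 => /eqP->.
rewrite leq_eqVlt => /orP[/eqP->//|h].
have h2 := IH h; rewrite [row_exit _ _ _ b'.+1]/=; case: ifP => // _.
by have := row_exit_le i S a b; lia.
Qed.

Lemma row_exit_ge i S a b : j <= b -> j <= row_exit i S a b.
Proof.
elim: b => //= b IH jb; case: ifP => // /andP[/andP[_ /= h] _]; apply: IH; lia.
Qed.

Lemma crossing_le i S lo k b : crossing i S lo k b <= b.
Proof. by elim: k b => //= k IH b; apply: leq_trans (IH _) (row_exit_le _ _ _ _).
Qed.

Lemma crossing_ge i S lo k b : j <= b -> j <= crossing i S lo k b.
Proof. by elim: k b => //= k IH b jb; apply/IH/row_exit_ge. Qed.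

(** Reverse paths do not cross, since two of them that meet coincide from there on. *)
Lemma crossing_mono i S lo k b b' : b <= b' ->
  crossing i S lo k b <= crossing i S lo k b'.
Proof. by elim: k b b' => //= k IH b b' h; apply/IH/row_exit_mono. Qed.

Lemma crossing_add i S lo k l b :
  crossing i S lo (k + l) b = crossing i S lo k (crossing i S (lo + k) l b).
Proof.
elim: l b => [|l IH] b; first by rewrite addn0.
by rewrite addnS /= IH addnS addnA -addnS.
Qed.

Lemma crossing_last i S lo k b : crossing i S lo k.+1 b
  = row_exit i S lo.+1 (crossing i S lo.+1 k b).
Proof. by rewrite -add1n crossing_add /= addn1. Qed.

End ReversePaths.

(** * Slide paths compared with reverse paths in one column *)

Section Column.
Variables (la : seq nat) (n : nat).
Hypothesis part : is_partition la n.
Variable j : nat.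
Hypothesis j0 : 0 < j.
Local Notation dg := (in_diagram la).
Local Notation reg := (region la j).
Local Notation std := (std_from la j).
Local Notation rx := (row_exit la j).
Local Notation cross := (crossing la j).
Local Notation goleft := (go_left la j).

Lemma region_intro i a b : dg (a, b) -> j <= b -> (b = j -> i <= a) -> reg i (a, b).
Proof.
move=> D h1 h2; rewrite /region D /=; have [E|] := eqVneq b j;
  first by rewrite E ltnn h2.
move=> ne; lia.
Qed.

Lemma std_from_le i S a b a' b' : std i S -> reg i (a, b) -> dg (a', b') ->
  a <= a' -> b <= b' -> S (a, b) <= S (a', b').
Proof.
move=> st rc; move: {2}(a' - a + (b' - b)) (erefl (a' - a + (b' - b))) => k.
have [_ /= hr] := andP rc; have := in_diagram_gt0 (region_in_diagram rc) => pos.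
elim: k a' b' => [|k IH] a' b' Ek D ha hb.
  by have [-> ->] : a' = a /\ b' = b by lia.
have [lt|ge] := ltnP a a'.
  have D' : dg (a'.-1, b') by apply: (in_diagram_sub part D); lia.
  apply: leq_trans (IH a'.-1 b' _ D' _ _) _; try lia.
  apply: ltnW; apply: st => //; last by rewrite /adj /= prednK ?eqxx ?orbT //; lia.
  by rewrite /region D' /=; lia.
have D' : dg (a', b'.-1) by apply: (in_diagram_sub part D); lia.
apply: leq_trans (IH a' b'.-1 _ D' _ _) _; try lia.
apply: ltnW; apply: st => //; last by rewrite /adj /= prednK ?eqxx ?orbT //; lia.
by rewrite /region D' /=; lia.
Qed.

Lemma std_from_lt i S a b a' b' : std i S -> reg i (a, b) -> dg (a',
  b') -> inj_on la S ->
  a <= a' -> b <= b' -> a + b < a' + b' -> S (a, b) < S (a', b').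
Proof.
move=> st rc D inj ha hb hab; have := std_from_le st rc D ha hb.
rewrite leq_eqVlt => /orP[/eqP/inj E|//]; have [] := E (region_in_diagram rc) D;
  lia.
Qed.

Section OnePath.
Variables (i hi : nat) (d : nat -> nat) (S : filling).
Hypothesis i0 : 0 < i.
Hypothesis ok : path_ok d i hi.
Hypothesis di : d i = j.
Hypothesis dhi : dg (hi, d hi.+1).
Hypothesis injS : inj_on la S.
Hypothesis stS : std i S.
Let T := unslide d i hi S.

Let ihi : i <= hi. Proof. by case: ok. Qed.

Lemma path_col_mono a b : i <= a -> a <= b -> b <= hi.+1 -> d a <= d b.
Proof. by move=> *; apply: path_mono ok _ _ _. Qed.

Lemma path_col_ge a : i <= a -> a <= hi.+1 -> j <= d a.
Proof. by move=> h1 h2; rewrite -di; apply: path_col_mono. Qed.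

Lemma path_region a b : i <= a <= hi -> d a <= b <= d a.+1 -> reg i (a, b).
Proof.
move=> h1 h2; have h3 := @path_col_mono a.+1 hi.+1; have h4 := @path_col_ge a.
by apply: region_intro; [apply: (in_diagram_sub part dhi); lia | lia | lia].
Qed.

Lemma path_region_prev a : i < a <= hi -> reg i (a.-1, d a).
Proof.
by case: a => // a ha; apply: path_region;
  rewrite /= ?leqnn ?andbT ?path_col_mono //; lia.
Qed.

Lemma unslide_off_path c : ~~ on_path d i hi c -> T c = S c.
Proof. by apply: unslide_off => //; apply: path_col_mono; lia. Qed.

(** [S] and [T] differ only on the slide path, and the two regions only at [(i, j)]. Below the end
    of the path, and in row [hi.+1] to the right of its last column, reverse paths test neither. *)
Lemma go_left_agree a b : (hi.+1 < a) || (a == hi.+1) && (d hi.+1 < b) ->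
  goleft i.+1 T a b = goleft i S a b.
Proof.
move=> h; have h4 := @path_col_ge hi.+1; rewrite /go_left.
have -> : reg i.+1 (a, b.-1) = reg i (a, b.-1) by rewrite /region /=; lia.
have -> : reg i.+1 (a.-1, b) = reg i (a.-1, b) by rewrite /region /=; lia.
rewrite !unslide_off_path //; rewrite /on_path /=; first by lia.
case/orP: h => [|/andP[/eqP -> h]] /=; lia.
Qed.

Lemma row_exit_agree a b : hi.+1 < a -> rx i.+1 T a b = rx i S a b.
Proof. by move=> ha; elim: b => //= b ->; rewrite go_left_agree ?ha. Qed.

Lemma crossing_agree k b : cross i.+1 T hi.+1 k b = cross i S hi.+1 k b.
Proof. by elim: k b => //= k IH b; rewrite row_exit_agree ?IH //; lia. Qed.

Section Forward.
Hypothesis stT : std i.+1 T.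

(** The slide path is retraced. At a cell entered from the left, the left entry of [S] is the old
    entry of this cell, which exceeds the one above it as [T] is sorted. At a cell entered from
    above, the top entry wins for the same reason. *)
Lemma forward_rpath a : i <= a <= hi -> rx i S a (d a.+1) = d a.
Proof.
move=> ha; have m1 : d a <= d a.+1 by apply: path_col_mono; lia.
have m2 : j <= d a by apply: path_col_ge; lia.
rewrite (@row_exit_skip _ _ _ _ _ _ (d a)) //.
- apply/eqP; rewrite eqn_leq row_exit_le /=; apply: row_exit_stop => //.
  rewrite /go_left; apply/negP => /andP[r1].
  have [E|ne] := eqVneq a i.
    by move: r1; rewrite E di /region /=; lia.
  have p1 : reg i (a.-1, d a).
    by apply: path_region_prev; lia.
  rewrite p1 /=; apply/negP; rewrite -leqNgt; apply: ltnW.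
  have <- : T (a, (d a).-1) = S (a, (d a).-1) by apply: unslide_off_path;
    rewrite /on_path /=; lia.
  have <- : T (a, d a) = S (a.-1, d a) by apply: unslide_col => //; lia.
  apply: stT.
  + by apply: region_intro; [exact: region_in_diagram r1 | | lia];
    case/andP: r1 => _ /=; lia.
  + by apply: (@region_in_diagram la j i); apply: path_region; lia.
  + by rewrite /adj /= prednK ?eqxx //; lia.
- move=> b hb; rewrite /go_left path_region /=; [|lia|lia].
  apply/implyP => r1.
  have <- : T (a.-1, b) = S (a.-1, b).
    apply: unslide_off_path; rewrite /on_path /=; apply/negP => h.
    by move: h; rewrite prednK; lia.
  have <- : T (a, b) = S (a, b.-1) by apply: unslide_row; lia.
  have a1 : 0 < a by lia.
  apply: stT; last by rewrite /adj /= prednK ?eqxx ?orbT.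
  + by apply: region_intro; [exact: region_in_diagram r1 | lia | lia].
  + by apply: (@region_in_diagram la j i); apply: path_region; lia.
Qed.

Lemma forward_crossing lo k : i <= lo.+1 -> lo + k <= hi ->
  cross i S lo k (d (lo + k).+1) = d lo.+1.
Proof.
move=> h1; elim: k => [|k IH] h2; first by rewrite addn0.
by rewrite /= forward_rpath; [rewrite addnS IH //; lia | lia].
Qed.

(** In column [(d a).+1] the left entry of [T] is [S (a.-1, d a)], smaller than the top entry
    because [S] is sorted. So a reverse path of [T] coming from the right turns up before it meets
    column [d a]. *)
Lemma forward_right a b : i < a <= hi -> d a < b -> dg (a,
  b) -> d a < rx i.+1 T a b.
Proof.
move=> ha hb D; apply: row_exit_stop => //; rewrite /go_left /=.
have m2 : j <= d a by apply: path_col_ge; lia.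
have D1 : dg (a.-1, (d a).+1) by apply: (in_diagram_sub part D); lia.
have -> : reg i.+1 (a.-1, (d a).+1) by apply: region_intro => //; lia.
rewrite negb_and; apply/orP; right; rewrite implyTb -leqNgt; apply: ltnW.
have -> : T (a, d a) = S (a.-1, d a) by apply: unslide_col => //; lia.
have -> : T (a.-1, (d a).+1) = S (a.-1, (d a).+1).
  by apply: unslide_off_path; rewrite /on_path /= prednK; lia.
apply: stS => //; last by rewrite /adj eqxx.
by apply: path_region_prev; lia.
Qed.

Lemma forward_right_crossing k b : 0 < k -> i + k <= hi -> d (i + k) < b ->
  dg (i + k, b) -> j < cross i.+1 T i k b.
Proof.
elim: k b => // k IH b _ h1 h2 D /=.
have h3 := @forward_right (i + k.+1) b;
  have h4 := row_exit_le la j i.+1 T (i + k.+1) b.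
case: k => [|k] in IH h1 h2 h3 h4 D *.
  by rewrite /=; have := @path_col_ge (i + 1); lia.
apply: IH => //; first by lia.
  by have := @path_col_mono (i + k.+1) (i + k.+2); lia.
apply: (in_diagram_sub part D); first by lia.
by have := @path_col_ge (i + k.+2); lia.
Qed.

Lemma forward_below k b : 0 < k -> dg (hi + k, b) -> j <= b ->
  cross i.+1 T i (hi - i + k) b = j -> cross i S hi k b <= d hi.+1.
Proof.
move=> k0 D jb; rewrite crossing_add subnKC // => E.
set b1 := cross i.+1 T hi k b in E.
have b1d : b1 <= d hi.
  rewrite leqNgt; apply/negP => h.
  have [Eh|ne] := eqVneq hi i.
    by move: E h; rewrite Eh subnn /= => ->; rewrite di ltnn.
  suff : j < cross i.+1 T i (hi - i) b1 by rewrite E ltnn.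
  apply: forward_right_crossing; rewrite ?subnKC //; first by lia.
  apply: (in_diagram_sub part D); first by lia.
  have := crossing_le la j i.+1 T hi k b; rewrite -/b1; have := @path_col_ge hi;
    lia.
move: b1d; rewrite /b1 {b1 E}; case: k k0 D => // k _ D.
rewrite !crossing_last crossing_agree.
set c := cross i S hi.+1 k b => h.
have dd : d hi <= d hi.+1 by apply: path_col_mono; lia.
have [cd|dc] := leqP c (d hi.+1);
  first by apply: leq_trans (row_exit_le _ _ _ _ _ _) cd.
rewrite (@row_exit_skip _ _ _ _ _ _ (d hi.+1)) ?row_exit_le //; first by lia.
move=> z hz; rewrite -go_left_agree; first by apply: (row_exit_go_left (b := c));
  lia.
by rewrite eqxx; lia.
Qed.

End Forward.

Section Backward.
Hypothesis rpath : forall a, i <= a <= hi -> rx i S a (d a.+1) = d a.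

Lemma backward_left a b : i <= a <= hi -> d a < b <= d a.+1 -> goleft i S a b.
Proof. by move=> ha hb; apply: (row_exit_go_left (b := d a.+1)); rewrite rpath. Qed.

Lemma backward_up a : i < a <= hi -> ~~ goleft i S a (d a).
Proof.
move=> ha; have h := @path_col_ge a; rewrite -(@rpath a); last by lia.
by apply: row_exit_stopped; rewrite rpath; lia.
Qed.

(** On the path [T] holds the entry of [S] at the predecessor; the start [(i, j)], where [T] is
    large, lies outside the region. *)
Lemma unslide_le c : reg i.+1 c -> T c <= S c.
Proof.
case: c => a b r; case: (boolP (on_path d i hi (a, b))) => [/andP[/= h1 h2]|h];
  last by rewrite unslide_off_path.
have rc : reg i (a, b) by apply: path_region.
have [h3|h3] := ltnP (d a) b.
  rewrite /T unslide_row; [|lia|lia].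
  apply: std_from_le (stS) _ (region_in_diagram rc) _ _; try lia.
  by apply: path_region; lia.
have E : b = d a by lia.
have ai : i < a by move: r; rewrite /region E /=; have := @path_col_ge a;
  have [->|] := eqVneq a i; rewrite ?di; lia.
rewrite E /T unslide_col //; [|lia].
apply: std_from_le (stS) _ _ _ _; rewrite -?E; try lia;
  last exact: region_in_diagram rc.
by rewrite E; apply: path_region_prev; lia.
Qed.

(** Only a target [c'] on the path needs care, where [T c'] is the entry of [S] at the predecessor.
    If this is [c], the order of [S] suffices; otherwise the reverse path preferred the predecessor
    to [c], whose entry is therefore smaller. *)
Lemma backward_std : std i.+1 T.
Proof.
move=> [a b] [a' b'] r D ad.
have rc : reg i (a, b) by move: r; rewrite /region /=; lia.
have [Doff|Don] := boolP (on_path d i hi (a', b')); last first.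
  by rewrite (unslide_off_path Don); apply: leq_ltn_trans (unslide_le r) _;
    apply: stS.
case/andP: (Doff) => /= h1 h2.
have [[E1 E2]|[E1 E2]] : (a' = a /\ b' = b.+1) \/ (a' = a.+1 /\ b' = b).
    by case/orP: ad => /eqP [-> ->]; [left | right].
- rewrite {}E1 {}E2 in D Doff h1 h2 ad *.
  have [h3|h3] := ltnP (d a) b.+1.
    rewrite [X in _ < X]/T unslide_row //=; last by lia.
    have [h4|h4] := ltnP (d a) b.
      rewrite /T unslide_row //=; last by lia.
      apply: stS; [by apply: path_region; lia | exact: region_in_diagram r|].
      by rewrite /adj /= prednK ?eqxx //; lia.
    have E : b = d a by lia.
    have ai : i < a by move: r; rewrite /region E /=; have := @path_col_ge a;
      have [->|] := eqVneq a i; rewrite ?di; lia.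
    rewrite E /T unslide_col //; [|lia].
    apply: stS; first by apply: path_region_prev; lia.
      by rewrite -E; exact: region_in_diagram r.
    by rewrite /adj /= prednK ?eqxx ?orbT //; lia.
  have E : b.+1 = d a by lia.
  have ai : i < a by move: r; rewrite /region /=; have [E2|] := eqVneq a i;
    [rewrite E2 di in E; lia|lia].
  rewrite E [X in _ < X]/T unslide_col //; [|lia].
  apply: leq_ltn_trans (unslide_le r) _.
  (* The predecessor of [c'] is above it, so the reverse path declined to go left to [c]. *)
  have : ~~ goleft i S a (d a) by apply: backward_up; lia.
  rewrite /go_left -E /= rc /= negb_imply -leqNgt => /andP[r1].
  rewrite leq_eqVlt => /orP[/eqP|//] /injS H.
  by have [] := H (region_in_diagram rc) (region_in_diagram r1); lia.
- rewrite {}E1 {}E2 in D Doff h1 h2 ad *.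
  have [h3|h3] := ltnP (d a.+1) b.
    rewrite [X in _ < X]/T unslide_row //=; last by lia.
    apply: leq_ltn_trans (unslide_le r) _.
    have /andP[_ /implyP] : goleft i S a.+1 b by apply: backward_left; lia.
    exact.
  have E : b = d a.+1 by lia.
  have ai : i < a.+1.
    move: r; rewrite /region /=; have [E2|] := eqVneq a.+1 i; last by lia.
    by move: E; rewrite E2 di; lia.
  rewrite E [X in _ < X]/T unslide_col /= -?E //; last by lia.
  case: (boolP (on_path d i hi (a, b))) => [/andP[/= h4 h5]|h4]; last first.
    exfalso; move: h4; rewrite /on_path /= -E leqnn andbT; apply/negP;
      rewrite negbK.
    have ai2 : i <= a.
      by have := ai; rewrite ltnS.
    by rewrite ai2 E path_col_mono //; lia.
  have [h6|h6] := ltnP (d a) b.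
    rewrite /T unslide_row //=; last by lia.
    apply: stS; [by apply: path_region; lia | exact: region_in_diagram r|].
    by rewrite /adj /= prednK ?eqxx //; lia.
  have E2 : b = d a by lia.
  have ai2 : i < a by move: r; rewrite /region E2 /=; have := @path_col_ge a;
    have [->|] := eqVneq a i; rewrite ?di; lia.
  rewrite E2 /T unslide_col //; [|lia].
  apply: stS; first by apply: path_region_prev; lia.
    by rewrite -E2; exact: region_in_diagram r.
  by rewrite /adj /= prednK ?eqxx ?orbT //; lia.
Qed.

(** For a column [y] with [d a.-1 < y <= d a], the top entry of [T] is [S (a.-1, y.-1)], smaller
    than [S (a, y.-1)], the left entry. So the reverse path of [T] cannot go up there. *)
Lemma backward_row_exit a b : i < a <= hi.+1 -> j <= b <= d a -> dg (a, b) ->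
  rx i.+1 T a b <= d a.-1.
Proof.
move=> ha hb D; rewrite leqNgt; apply/negP => h.
have yb := row_exit_le la j i.+1 T a b.
have dj : j <= d a.-1 by apply: path_col_ge; lia.
have := @row_exit_stopped la j i.+1 T a b; move: h yb; set y := rx _ _ _ _ => h yb.
move=> /(_ _)/negP[|]; first by lia.
have D1 : dg (a, y.-1) by apply: (in_diagram_sub part D); lia.
rewrite /go_left; apply/andP; split; first by apply: region_intro => //; lia.
apply/implyP => _.
have Ea : a.-1.+1 = a by lia.
rewrite /T unslide_row ?Ea; [|lia|lia].
rewrite unslide_off //; [|by apply: path_col_mono; lia|].
  apply: stS => //; last by rewrite /adj /= Ea eqxx orbT.
  by apply: path_region; rewrite ?Ea; lia.
by rewrite /on_path /=; lia.
Qed.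

Lemma backward_crossing k b : 0 < k -> i + k <= hi.+1 -> j <= b <= d (i + k) ->
  dg (i + k, b) -> cross i.+1 T i k b = j.
Proof.
move=> k0 h1 h2 D; apply/eqP; rewrite eqn_leq crossing_ge ?andbT; last by lia.
elim: k b k0 h1 h2 D => // k IH b _ h1 h2 D /=.
have h3 := @backward_row_exit (i + k.+1) b.
have h4 : j <= rx i.+1 T (i + k.+1) b by apply: row_exit_ge; lia.
have h5 := row_exit_le la j i.+1 T (i + k.+1) b.
rewrite addnS /= in h3 D h2 h1 h4 h5 *.
case: k => [|k] in IH h1 h2 h3 h4 h5 D *.
  by rewrite addn0 di in h1 h2 h3 D *; apply: h3 => //; lia.
have {}h3 : rx i.+1 T (i + k.+1).+1 b <= d (i + k.+1) by apply: h3 => //; lia.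
  apply: IH => //; [lia|lia|].
by apply: (in_diagram_sub part D); lia.
Qed.

(** Converse of [forward_below]. A reverse path reaching row [hi.+1] to the right of [d hi.+1] runs
    left to that column in [T] as in [S]; from there on [backward_crossing] confines it. *)
Lemma backward_below k b : 0 < k -> dg (hi + k, b) -> j <= b ->
  cross i S hi k b <= d hi.+1 -> cross i.+1 T i (hi - i + k) b = j.
Proof.
case: k => // k _ D jb.
rewrite crossing_last addnS -addSn crossing_add addnS subnKC // crossing_agree;
  set c := cross i S hi.+1 k b => h.
have cb : j <= c <= b by rewrite crossing_le crossing_ge.
have D1 : dg (hi.+1, c) by apply: (in_diagram_sub part D); lia.
have dj : j <= d hi.+1 by apply: path_col_ge; lia.
have Ehi : i + (hi - i).+1 = hi.+1 by rewrite addnS subnKC.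
have [cd|dc] := leqP c (d hi.+1).
  by apply: backward_crossing; rewrite // Ehi; lia.
have -> : cross i.+1 T i (hi - i).+1 c = cross i.+1 T i (hi - i).+1 (d hi.+1).
  rewrite /= Ehi (@row_exit_skip _ _ _ _ _ _ (d hi.+1)) //; first by lia.
  move=> z hz; rewrite go_left_agree;
    first by apply: (row_exit_go_left (b := c)); lia.
  by rewrite eqxx; lia.
apply: backward_crossing; rewrite // Ehi //.
  by rewrite leqnn andbT; lia.
by apply: (in_diagram_sub part D1); lia.
Qed.

End Backward.
End OnePath.
End Column.

(** * Codes of the slides in a column *)

Section InsertDelete.
Variable A : Type.
Implicit Types (u : seq A) (v : A).

Definition insert_at p v u := take p u ++ v :: drop p u.
Definition delete_at p u := take p u ++ drop p.+1 u.

Lemma size_insert_at p v u : size (insert_at p v u) = (size u).+1.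
Proof. by rewrite size_cat /= addnS -size_cat cat_take_drop. Qed.

Lemma size_delete_at p u : p < size u -> size (delete_at p u) = (size u).-1.
Proof. by move=> h; rewrite size_cat size_take size_drop h; lia. Qed.

Lemma nth_insert_at x0 p v u q : p <= size u ->
  nth x0 (insert_at p v u) q =
  if q < p then nth x0 u q else if q == p then v else nth x0 u q.-1.
Proof.
move=> h; rewrite nth_cat size_takel //; case: ltnP => qp;
  first by rewrite nth_take.
have [->|ne] := eqVneq q p; first by rewrite subnn.
have [k ->] : exists k, q = p + k.+1 by exists (q - p).-1; lia.
by rewrite addKn /= nth_drop addnS.
Qed.

Lemma nth_delete_at x0 p u q : p < size u ->
  nth x0 (delete_at p u) q = if q < p then nth x0 u q else nth x0 u q.+1.
Proof.
move=> h; rewrite nth_cat size_takel; last exact: ltnW.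
case: ltnP => qp; first by rewrite nth_take.
by rewrite nth_drop; congr nth; lia.
Qed.

Lemma delete_insert_at p v u : p <= size u -> delete_at p (insert_at p v u) = u.
Proof.
move=> h; rewrite /delete_at /insert_at take_size_cat ?size_takel //.
by rewrite -cat_rcons drop_size_cat ?cat_take_drop // size_rcons size_takel.
Qed.

Lemma insert_delete_at x0 p u : p < size u ->
  insert_at p (nth x0 u p) (delete_at p u) = u.
Proof.
move=> h; rewrite /delete_at /insert_at take_size_cat ?size_takel //;
  try exact: ltnW.
by rewrite drop_size_cat ?size_takel -?drop_nth ?cat_take_drop //; exact: ltnW.
Qed.

End InsertDelete.

Section Codes.
Variables (la : seq nat) (n : nat).
Hypothesis part : is_partition la n.
Variable j : nat.
Hypothesis j0 : 0 < j.
Local Notation dg := (in_diagram la).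
Local Notation reg := (region la j).
Local Notation std := (std_from la j).
Local Notation rx := (row_exit la j).
Local Notation cross := (crossing la j).
Local Notation r := (col_height la j).

(* A code [u] at stage [i] lists the hook function on the cells [(i + q, j)],
   each value being shifted by the leg length so as to be nonnegative. *)
Definition candidate i (u : seq nat) q := r - (i + q) <= nth 0 u q.
Definition candidate_col i (u : seq nat) q := j + nth 0 u q - (r - (i + q)).

(** The [crossing] condition says that the reverse path from the candidate cell ends at [(i, j)]: it
    leaves row [i] upwards in column [j], which is recorded as its entry into row [i.-1]. *)
Definition valid i (S : filling) (u : seq nat) : bool :=
  (size u == r.+1 - i) &&
  all (fun q => candidate i u q ==>
         dg (i + q, candidate_col i u q) &&
           (cross i S i.-1 q.+1 (candidate_col i u q) == j))
      (iota 0 (size u)).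

(* The candidate whose reverse path is the rightmost one. *)
Definition champion i S u p : Prop :=
  [/\ p < size u, candidate i u p &
    forall q, q < size u -> q != p -> candidate i u q ->
      if q < p then candidate_col i u q < cross i S (i + q) (p - q)
        (candidate_col i u p)
      else cross i S (i + p) (q - p) (candidate_col i u q) <= candidate_col i u p].

(** The reverse path of the candidate [p] in the format of [on_path]: its column when passing from
    row [a] to row [a.-1]. For [a = (i + p).+1] this is the column of the candidate cell itself. *)
Definition champion_path i S u p (a : nat) : nat :=
  cross i S a.-1 ((i + p).+1 - a) (candidate_col i u p).

Lemma validP i S u : reflect
  (size u = r.+1 - i /\ forall q, q < size u -> candidate i u q ->
     dg (i + q, candidate_col i u q) /\ cross i S i.-1 q.+1 (candidate_col i u q)
       = j)
  (valid i S u).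
Proof.
apply: (iffP andP) => [[/eqP h1 /allP h2]|[h1 h2]]; split=> //.
- by move=> q qu cq; have := h2 q; rewrite mem_iota qu cq => /(_ isT) /andP[? /eqP].
- by apply/eqP.
- apply/allP => q; rewrite mem_iota => /= qu; apply/implyP => cq.
  by have [h3 h4] := h2 q qu cq; apply/andP; split=> //; apply/eqP.
Qed.

Lemma champion_uniq i S u p p' : champion i S u p -> champion i S u p' -> p = p'.
Proof.
wlog pp : p p' / p < p' => [W h h'|].
  by have [lt|gt|//] := ltngtP p p'; [apply: W | apply/esym/W].
move=> [pu cp h] [pu' cp' h'].
have n1 : p' != p by lia.
have n2 : p != p' by lia.
have := h p' pu' n1 cp'; have := h' p pu n2 cp; rewrite pp.
have -> : p' < p = false by lia.
by lia.
Qed.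

(** Induction on the prefix of positions: the next candidate either passes to the right of the
    current champion or loses to it. [crossing_mono] makes the comparison transitive; ties go to the
    upper candidate. *)
Lemma champion_exists i S u : 0 < size u -> candidate i u (size u).-1 ->
  exists p, champion i S u p.
Proof.
move=> su cl.
pose chm m p := [/\ p < m, candidate i u p & forall q,
  q < m -> q != p -> candidate i u q ->
      if q < p then candidate_col i u q < cross i S (i + q) (p - q)
        (candidate_col i u p)
      else cross i S (i + p) (q - p) (candidate_col i u q) <= candidate_col i u p].
have H m : (forall q, q < m -> ~~ candidate i u q) \/ exists p, chm m p.
  elim: m => [|m IH]; first by left.
  have [cm|ncm] := boolP (candidate i u m); last first.
    case: IH => [N|[p [pm cp h]]].
      by left=> q; rewrite ltnS leq_eqVlt => /orP[/eqP->|/N].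
    right; exists p; split=> // [|q]; first exact: ltnW.
    rewrite ltnS leq_eqVlt => /orP[/eqP-> _|]; last exact: h.
    by rewrite (negPf ncm).
  right; case: IH => [N|[p [pm cp h]]].
    exists m; split=> // q; rewrite ltnS leq_eqVlt => /orP[/eqP->|/N/negPf->//].
    by rewrite eqxx.
  have [le|gt] := leqP (cross i S (i + p) (m - p) (candidate_col i u m))
    (candidate_col i u p).
    exists p; split=> // [|q]; first exact: ltnW.
    rewrite ltnS leq_eqVlt => /orP[/eqP-> _ _|]; last exact: h.
    by have -> : m < p = false by lia.
  exists m; split=> // q; rewrite ltnS leq_eqVlt => /orP[/eqP->|qm nq cq].
    by rewrite eqxx.
  rewrite qm; have [Eq|nqp] := eqVneq q p; first by rewrite Eq.
  have := h q qm nqp cq; have [qp|pq] := ltnP q p => hq.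
    apply: leq_trans hq _.
    have -> : m - q = (p - q) + (m - p) by lia.
    rewrite crossing_add; have -> : i + q + (p - q) = i + p by lia.
    by apply/crossing_mono/ltnW.
  (* If the path from [m] were weakly left of candidate [q], it would by monotonicity also be weakly
     left of [p]. *)
  rewrite ltnNge; apply/negP => le.
  have : cross i S (i + p) (m - p) (candidate_col i u m) <= candidate_col i u p.
    apply: leq_trans hq.
    have -> : m - p = (q - p) + (m - q) by lia.
    rewrite crossing_add; have -> : i + p + (q - p) = i + q by lia.
    exact: crossing_mono.
  by rewrite leqNgt gt.
case: (H (size u)) => [/(_ (size u).-1)|[p hp]]; last by exists p.
by rewrite cl prednK // leqnn => /(_ isT).
Qed.

(** An entry of [u'] at a position below [p] is now read one row higher, where the leg is longer by
    one; unchanged, it stands for a hook value smaller by one. So the plain insertion moves the end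
    cells in rows [i.+1] to [hi] diagonally up-left and keeps those below. *)
Lemma forward_code i S T u' hi d : 0 < i -> path_ok d i hi -> d i = j ->
  dg (hi, d hi.+1) -> inj_on la S -> std i S -> T = unslide d i hi S ->
  std i.+1 T -> valid i.+1 T u' ->
  let p := hi - i in
  let u := insert_at p (d hi.+1 - j + (r - hi)) u' in
  [/\ valid i S u, champion i S u p, candidate_col i u p = d hi.+1 &
      forall a, i <= a <= hi.+1 -> d a = champion_path i S u p a].
Proof.
move=> i0 ok di dhi injS stS ET stT /validP[su' vu'] p u.
have ihi : i <= hi by case: ok.
have dj a : i <= a -> a <= hi.+1 -> j <= d a by move=> h1 h2;
  apply: (path_col_ge ok di).
have hir : hi <= r.
  suff : dg (hi, j) by rewrite (in_diagram_height part) // => /andP[].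
  by apply: (in_diagram_sub part dhi); have := dj hi.+1; lia.
have pu : p <= size u' by rewrite su' /p; lia.
have ip : i + p = hi by rewrite subnKC.
have Eu q : nth 0 u q = if q < p then nth 0 u' q else
    if q == p then d hi.+1 - j + (r - hi) else nth 0 u' q.-1 by apply:
      nth_insert_at.
have djh : j <= d hi.+1 by apply: dj; lia.
have colp : candidate_col i u p = d hi.+1.
  by rewrite /candidate_col Eu ltnn eqxx ip; lia.
have candp : candidate i u p by rewrite /candidate Eu ltnn eqxx ip; lia.
subst T.
have fc lo k : i <= lo.+1 -> lo + k <= hi ->
    cross i S lo k (d (lo + k).+1) = d lo.+1.
  by move=> *; apply: (forward_crossing part j0 i0 ok di dhi).
have fcp lo : i <= lo.+1 -> lo <= hi -> cross i S lo (hi - lo) (d hi.+1) = d lo.+1.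
  by move=> h1 h2; rewrite -(fc lo (hi - lo)) ?subnKC //.
(* Before the shift the cell was [((i + q).+1, candidate_col i u q + 1)]. To the right of the slide
   path its reverse path in [T] would miss column [j], by [forward_right_crossing]. *)
have lt_case q : q < p -> candidate i u q -> dg (i + q,
  candidate_col i u q) /\ candidate_col i u q < d (i + q).+1.
  move=> qp; rewrite /candidate /candidate_col Eu qp => cq.
  have := vu' q; have -> : q < size u' by lia.
  have c' : candidate i.+1 u' q by rewrite /candidate; lia.
  rewrite c' => /(_ isT isT) [D E].
  have Ec : candidate_col i.+1 u' q = (j + nth 0 u' q - (r - (i + q))).+1.
    by rewrite /candidate_col; lia.
  rewrite Ec in D E; split; first by apply: (in_diagram_sub part D); lia.
  rewrite ltnNge; apply/negP => h.
  have := forward_right_crossing part j0 i0 ok di dhi stS (k := q.+1) (b := (j +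
    nth 0 u' q - (r - (i + q))).+1).
  rewrite E ltnn addnS; move=> /(_ isT _ _ D) H.
  by have := H _ _; rewrite /= => /(_ _ _); lia.
(* Below the end of the slide the candidate cells are unchanged and [forward_below] applies. *)
have gt_case q : p < q -> q < size u -> candidate i u q ->
    dg (i + q, candidate_col i u q) /\ cross i S hi (q - p) (candidate_col i u q)
      <= d hi.+1.
  move=> pq qu; rewrite /candidate /candidate_col Eu.
  have -> : q < p = false by lia.
  have -> : q == p = false by lia.
  move=> cq; have := vu' q.-1; rewrite size_insert_at in qu.
  have -> : q.-1 < size u' by lia.
  have c' : candidate i.+1 u' q.-1 by rewrite /candidate; lia.
  have Ei : i.+1 + q.-1 = i + q by lia.
  have Ec : candidate_col i.+1 u' q.-1 = j + nth 0 u' q.-1 - (r - (i + q)).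
    by rewrite /candidate_col; lia.
  rewrite c' Ei Ec prednK; last by lia.
  move=> /(_ isT isT) [D E]; split=> //.
  apply: (forward_below part j0 i0 ok di dhi stS) => //.
  - by lia.
  - by have -> : hi + (q - p) = i + q by lia.
  - by lia.
  - by have -> : hi - i + (q - p) = q by lia.
have crossp : cross i S i.-1 p.+1 (d hi.+1) = j.
  have <- : hi - i.-1 = p.+1 by lia.
  by have := fcp i.-1; rewrite prednK // di; apply; lia.
split=> //.
- apply/validP; split=> [|q qu cq]; first by rewrite size_insert_at su'; lia.
  have [qp|pq|Eq] := ltngtP q p.
  + have [D lt] := lt_case q qp cq; split=> //.
    apply/eqP; rewrite eqn_leq crossing_ge ?andbT;
      last by rewrite /candidate_col; move: cq; rewrite /candidate; lia.
    rewrite -[X in _ <= X]di; have := fc i.-1 q.+1;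
      rewrite prednK // addnS -addSn prednK // => <-; [|lia|lia].
    by apply/crossing_mono/ltnW.
  + have [D le] := gt_case q pq qu cq; split=> //.
    apply/eqP; rewrite eqn_leq crossing_ge ?andbT;
      last by rewrite /candidate_col; move: cq; rewrite /candidate; lia.
    have -> : q.+1 = p.+1 + (q - p) by lia.
    rewrite crossing_add; have -> : i.-1 + p.+1 = hi by lia.
    by rewrite -[X in _ <= X]crossp; apply: crossing_mono.
  + by rewrite Eq colp ip.
- split=> //; first by rewrite size_insert_at ltnS.
  move=> q qu nq cq; rewrite colp; case: ltnP => qp.
    have [D lt] := lt_case q qp cq.
    have := fcp (i + q); have -> : hi - (i + q) = p - q by lia.
    by move=> ->; lia.
  by rewrite ip; apply: (gt_case q _ qu cq).2; lia.
- move=> a ha; rewrite /champion_path colp ip.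
  have := fcp a.-1; rewrite prednK; last by lia.
  have -> : hi - a.-1 = hi.+1 - a by lia.
  by move=> ->; lia.
Qed.

(** Inverse of [forward_code]: the slide is undone along the reverse path of the champion, and the
    entry of the champion is deleted. *)
Lemma backward_code i S u p : 0 < i -> valid i S u -> champion i S u p ->
  inj_on la S -> std i S ->
  let d := champion_path i S u p in
  [/\ path_ok d i (i + p), d i = j, d (i + p).+1 = candidate_col i u p,
      dg (i + p, d (i + p).+1) &
      std i.+1 (unslide d i (i + p) S) /\ valid i.+1 (unslide d i (i + p) S)
        (delete_at p u)].
Proof.
move=> i0 /validP[su vu] [pu cp chp] injS stS d.
have [Dp Ep] := vu p pu cp.
have dE : d (i + p).+1 = candidate_col i u p by rewrite /d /champion_path subnn.
have rp a : i <= a <= i + p -> rx i S a (d a.+1) = d a.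
  move=> ha; rewrite /d /champion_path.
  have -> : (i + p).+1 - a = ((i + p).+1 - a.+1).+1 by lia.
  by rewrite crossing_last prednK //; lia.
have ok : path_ok d i (i + p).
  by split=> [|a ha]; [exact: leq_addr | rewrite -(rp a ha) row_exit_le].
have di : d i = j by rewrite /d /champion_path -addnS addKn.
rewrite -dE in Dp.
split=> //; split; first exact: (backward_std part j0 i0 ok di Dp injS stS rp).
have su1 : 0 < size u by lia.
apply/validP; split=> [|q qu cq]; first by rewrite size_delete_at // su; lia.
rewrite size_delete_at // in qu.
set T := unslide _ _ _ _; have dm := path_col_mono ok.
have hir : i + p <= r.
  by move: pu; rewrite su; lia.
move: cq; rewrite /candidate /candidate_col nth_delete_at //; case: ltnP => qp cq.
- set c := j + _ - _.
  have D : dg ((i + q).+1, d (i + q).+1).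
    apply: (in_diagram_sub part Dp); first by lia.
    by rewrite dm ?andbT; [have := path_col_ge ok di (a := (i + q).+1) | ..]; lia.
  (* A candidate at stage [i] lies strictly left of the champion path, so its shift by one column is
     still weakly left of it. *)
  have cd : j <= c <= d (i + q).+1.
    have [cq'|ncq] := leqP (r - (i + q)) (nth 0 u q).
      have qu2 : q < size u by lia.
      have := chp q qu2; have -> : q != p by lia.
      rewrite qp => /(_ isT cq'); rewrite /candidate_col -/(candidate_col i u p).
      have -> : cross i S (i + q) (p - q) (candidate_col i u p) = d (i + q).+1.
        by rewrite /d /champion_path /=; congr crossing; lia.
      by rewrite /c; lia.
    (* Here the hook value rises from -1 to 0: the entry is a candidate only after the deletion. *)
    have -> : c = j by rewrite /c; lia.
    by rewrite leqnn /=; apply: (path_col_ge ok di); lia.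
  have Dc : dg (i + q.+1, c) by rewrite addnS; apply: (in_diagram_sub part D); lia.
  rewrite addSnnS; split=> //.
  apply: (backward_crossing part j0 i0 ok di Dp stS) => //; first by lia.
  by rewrite addnS.
- set c := j + _ - _.
  have cq' : candidate i u q.+1 by rewrite /candidate; lia.
  have qu2 : q.+1 < size u by lia.
  have Ec : candidate_col i u q.+1 = c by rewrite /candidate_col /c; lia.
  have [D E] := vu _ qu2 cq'; rewrite Ec in D E.
  rewrite addSnnS; split=> //.
  have := chp _ qu2; have -> : q.+1 != p by lia.
  have -> : q.+1 < p = false by lia.
  rewrite Ec -dE => /(_ isT cq') h.
  have := backward_below part j0 i0 ok di Dp stS (k := q.+1 - p) (b := c).
  have -> : i + p + (q.+1 - p) = i + q.+1 by lia.
  have -> : i + p - i + (q.+1 - p) = q.+1 by lia.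
  by apply=> //; [lia|rewrite /c; lia].
Qed.

End Codes.

(** * Counting preimages *)

Section Words.

(** A finite box containing all valid codes, by [valid_words], so that they can be counted. *)
Fixpoint words B k : seq (seq nat) :=
  if k is k'.+1 then [seq a :: w | a <- iota 0 B, w <- words B k'] else [:: [::]].

Lemma mem_words B k u : (u \in words B k) = (size u == k) && all (fun a => a < B) u.
Proof.
elim: k u => [|k IH] [|a u] //=.
- by apply/negbTE/negP => /allpairsP[[a w] [_ _ E]]; move: E; rewrite ?E.
- rewrite eqSS; apply/allpairsP/idP => [[[b w] [/= h1 h2 [-> ->]]]|h].
    by move: h1 h2; rewrite mem_iota IH /= => -> /andP[-> ->].
  exists (a, u); rewrite /= mem_iota IH.
  by case/and3P: h => -> -> ->.
Qed.

Lemma uniq_words B k : uniq (words B k).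
Proof.
elim: k => //= k IH; apply: allpairs_uniq; rewrite ?iota_uniq //.
by move=> [a u] [b w] _ _ [-> ->].
Qed.

(** Comparing sizes through a relation, used in both directions, replaces the construction of
    mutually inverse maps. *)
Lemma size_rel_le (X Y : eqType) (xs : seq X) (ys : seq Y) (R : X -> Y -> Prop) :
  uniq xs -> (forall x, x \in xs -> exists2 y, y \in ys & R x y) ->
  (forall x x' y, x \in xs -> x' \in xs -> y \in ys -> R x y -> R x' y -> x = x') ->
  size xs <= size ys.
Proof.
elim: xs ys => //= x xs IH ys /andP[xn ux] ex inj.
have [y yin Rxy] := ex x (mem_head _ _).
have sy : size ys = (size (rem y ys)).+1.
  by rewrite size_rem // prednK //; case: ys yin {ex inj}.
rewrite sy ltnS; apply: IH => // [x' x'in|x1 x2 y' h1 h2 h3].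
- have [y' y'in R'] := ex x' (mem_behead (s := x :: xs) x'in).
  exists y' => //; have [E|ne] := eqVneq y' y.
    have E2 : x = x' by apply: inj yin Rxy _;
      rewrite ?mem_head -?E // inE x'in orbT.
    by rewrite E2 x'in in xn.
  have := perm_to_rem yin => /perm_mem/(_ y'); rewrite y'in inE.
  by rewrite (negPf ne).
- by apply: inj; rewrite ?inE ?h1 ?h2 ?orbT //; apply: mem_rem h3.
Qed.

End Words.

Section Stage.
Variables (la : seq nat) (n : nat).
Hypothesis part : is_partition la n.
Local Notation dg := (in_diagram la).

Definition is_std j i (T : filling) : bool :=
  all (fun c => all (fun c' => (region la j i c && adj c c') ==> (T c < T c'))
    (cells la)) (cells la).

Lemma is_stdP j i T : reflect (std_from la j i T) (is_std j i T).
Proof.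
apply: (iffP allP) => [H c c' rc dc' a|H c _].
  have := H c; rewrite (mem_cells part) (region_in_diagram rc) =>
    /(_ isT)/allP/(_ c').
  by rewrite (mem_cells part) dc' rc a => /(_ isT).
apply/allP => c'; rewrite (mem_cells part) => dc'; apply/implyP => /andP[rc a].
exact: H.
Qed.

Lemma is_standardE T : is_standard la T = is_std 1 1 T.
Proof.
apply/allP/is_stdP => [H c c' rc dc'|H c].
  have := H c; rewrite (mem_cells part) (region_in_diagram rc) =>
    /(_ isT)/andP[/implyP h1 /implyP h2].
  by move=> /orP[]/eqP E; rewrite E in dc' *; auto.
rewrite (mem_cells part); case: c => a b D; have := in_diagram_gt0 D => pos.
have rc : region la 1 1 (a, b) by rewrite /region D /=; lia.
by apply/andP; split; apply/implyP => D'; apply: H rc D' _; rewrite /adj eqxx ?orbT.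
Qed.

Lemma std_slide i j T : inj_on la T -> dg (i, j) -> std_from la j i.+1 T ->
  std_from la j i (slide la T (i, j)).
Proof.
move=> inj D st; have pos := in_diagram_gt0 D.
have sm : sumn la = n by case/andP: part => _ /eqP.
apply: (slide_go_std part) => //.
- by rewrite /region D /= eqxx leqnn orbT.
- by rewrite sm /=; lia.
- move=> [a b] c' rc dc' ad ne; apply: st => //.
  move: rc ne; rewrite /region xpair_eqE /= => /andP[-> /=].
  have [->|] := eqVneq b j; lia.
- move=> [a b] c' /andP[_ /= rc] /orP[]/eqP[E1 E2]; lia.
Qed.

Lemma std_next_column j T : 0 < j ->
  is_std j (col_height la j).+1 T = is_std j.+1 1 T.
Proof.
move=> j0; apply/is_stdP/is_stdP => H c c' rc; apply: H; move: rc; case: c => a b.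
  move=> /andP[D /= h]; have /andP[a1 b1] := in_diagram_gt0 D; rewrite /region D /=.
  by lia.
move=> /andP[D /=]; have /andP[a1 b1] := in_diagram_gt0 D; rewrite /region D /=;
  have [Eb|] := eqVneq b j; last by lia.
by move: D; rewrite Eb (in_diagram_height part) //; lia.
Qed.

Lemma slide_go_stop f i j T c : std_from la j i T -> region la j i c ->
  slide_go f la T c = T.
Proof.
case: f => // f st rc; rewrite slide_goS;
  case: (slide_targetP la T c) => // q a dq _.
by rewrite ltnNge (ltnW (st _ _ rc dq a)).
Qed.

(** At a path cell, the entry waiting in the next one is that of [S] at the current cell. As [S] is
    sorted, it is smaller than the other neighbour and than the sliding entry, which belongs to the
    end of the path. So the slide follows the path and stops at its end. *)
Lemma slide_unslide i j hi S f d lo : 0 < j -> 0 < i -> inj_on la S ->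
  std_from la j i S -> i <= lo -> j <= d lo -> path_ok d lo hi ->
  dg (hi, d hi.+1) -> (hi - lo) + (d hi.+1 - d lo) <= f ->
  slide_go f la (unslide d lo hi S) (lo, d lo) = S.
Proof.
move=> j0 i0 inj st; elim: f d lo => [|f IH] d lo il jd ok dhi hf.
all: have [lh mono] := ok; have m1 : d lo <= d lo.+1 by apply: mono; lia.
all: have m2 : d lo.+1 <= d hi.+1 by apply: path_mono ok _ _ _; lia.
all: have Dp b : d lo <= b <= d hi.+1 -> dg (lo, b) by move=> hb;
  apply: (in_diagram_sub part dhi); lia.
all: have rp b : d lo <= b <= d hi.+1 -> region la j i (lo, b) by move=> hb;
  apply: (region_intro part j0) => //; [exact: Dp|lia].
  have E : lo = hi by lia.
  by rewrite E unslide_end // -E; lia.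
have [lt|ge] := ltnP (d lo) (d lo.+1).
  have Dq : dg (lo, (d lo).+1) by apply: Dp; lia.
  have Tq : unslide d lo hi S (lo, (d lo).+1) = S (lo, d lo).
    by rewrite unslide_row //=; lia.
  have nx : slide_target la (unslide d lo hi S) (lo, d lo) = Some (lo, (d lo).+1).
    rewrite /slide_target /= Dq; case: ifP => // D2; rewrite Tq unslide_off //.
      rewrite st // ?rp //; first by lia.
      by rewrite /adj eqxx orbT.
    by rewrite /on_path /=; lia.
  rewrite slide_goS nx Tq unslide_start.
  have -> : S (lo, d lo) < S (hi, d hi.+1).
    by apply: (std_from_lt part j0 st) => //; first [by apply: rp; lia | lia].
  rewrite unslide_right // swapfK.
  set d' := fun x => _; have E1 : d' lo = (d lo).+1 by rewrite /d' eqxx.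
  have E2 x : lo < x -> d' x = d x by rewrite /d'; case: eqP => //; lia.
  rewrite -E1; apply: IH; rewrite ?E1 ?(E2 hi.+1) //; [by lia| |by lia].
  split=> // x hx; rewrite (E2 x.+1); last by lia.
  have [->|ne] := eqVneq x lo; first by rewrite E1.
  by rewrite E2; [apply: mono|lia].
have E : d lo = d lo.+1 by lia.
have [lt|le] := ltnP lo hi.
  have Dq : dg (lo.+1, d lo) by apply: (in_diagram_sub part dhi); lia.
  have Tq : unslide d lo hi S (lo.+1, d lo) = S (lo, d lo).
    by rewrite E unslide_col //=; lia.
  have nx : slide_target la (unslide d lo hi S) (lo, d lo) = Some (lo.+1, d lo).
    rewrite /slide_target /= Dq; case: ifP => // D2; rewrite Tq unslide_off //.
      rewrite ltnNge ltnW // st // ?rp //; first by lia.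
      by rewrite /adj eqxx.
    by rewrite /on_path /=; lia.
  rewrite slide_goS nx Tq unslide_start.
  have -> : S (lo, d lo) < S (hi, d hi.+1).
    by apply: (std_from_lt part j0 st) => //; first [by apply: rp; lia | lia].
  rewrite unslide_down // swapfK [in X in slide_go _ _ _ X]E.
  apply: IH => //; [by lia|by lia| |by lia].
  by split=> // x hx; apply: mono; lia.
have Eh : hi = lo by lia.
rewrite Eh unslide_end //; apply: slide_go_stop st _; apply: rp; lia.
Qed.

Lemma unslide_tab d lo hi (s : {perm 'I_n}) : 0 < lo -> 0 < d lo ->
  path_ok d lo hi -> dg (hi, d hi.+1) ->
  exists t : {perm 'I_n}, unslide d lo hi (tab_of la s) = tab_of la t.
Proof.
move: {2}(hi - lo + (d hi.+1 - d lo)).+1 (ltnSn (hi - lo + (d hi.+1 - d lo))) => f.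
elim: f d lo => // f IH d lo hf lo0 d0 ok dhi.
have [lh mono] := ok; have m1 : d lo <= d lo.+1 by apply: mono; lia.
have m2 : d lo.+1 <= d hi.+1 by apply: path_mono ok _ _ _; lia.
have Dp a b : lo <= a <= hi -> d lo <= b <= d hi.+1 -> dg (a, b).
  by move=> ha hb; apply: (in_diagram_sub part dhi); lia.
have [lt|ge] := ltnP (d lo) (d lo.+1).
  rewrite unslide_right //.
  set d' := fun x : nat => if x == lo then _ else _;
    have E1 : d' lo = (d lo).+1 by rewrite /d' eqxx.
  have E2 x : lo < x -> d' x = d x by rewrite /d'; case: eqP => //; lia.
  have [|||||t ->] := IH d' lo; rewrite ?E1 ?(E2 hi.+1) //; first by lia.
    split=> // x hx; rewrite (E2 x.+1); last by lia.
    have [->|ne] := eqVneq x lo; first by rewrite E1.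
    by rewrite E2; [apply: mono|lia].
  by apply: (tab_swap part); apply: Dp; lia.
have E : d lo = d lo.+1 by lia.
have [lt|le] := ltnP lo hi.
  rewrite unslide_down //.
  have [||||t ->] := IH d lo.+1 _ _ _ _ dhi; try lia.
    by split=> // x hx; apply: mono; lia.
  by apply: (tab_swap part); apply: Dp; lia.
have -> : hi = lo by lia.
by exists s; rewrite unslide_end.
Qed.

End Stage.

Section Counting.
Variables (la : seq nat) (n : nat).
Hypothesis part : is_partition la n.
Local Notation dg := (in_diagram la).
Local Notation tab s := (@tab_of n la s).
Implicit Types s t : {perm 'I_n}.

Definition slide_perm (z : cell) s : {perm 'I_n} :=
  odflt s [pick t : {perm 'I_n} |
    all (fun c => slide la (tab s) z c == tab t c) (cells la)].

Lemma slide_permE z s : dg z -> tab (slide_perm z s) = slide la (tab s) z.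
Proof.
move=> D; rewrite /slide_perm; have [t E] := slide_go_tab part (sumn la) s D.
rewrite -/(slide la (tab s) z) in E.
case: pickP => [t' /allP H|/(_ t)/allP[]] /=; last by move=> c _; rewrite E.
rewrite E; congr tab_of; apply: (tab_eq part) => c dc.
by rewrite -E; apply/esym/eqP/H; rewrite (mem_cells part).
Qed.

Definition num_codes j i s : nat :=
  count (valid la j i (tab s)) (words (n.+2 + col_height la j) ((col_height la
    j).+1 - i)).

(** A candidate has a column bounded by [in_diagram_bound]; an entry that is no candidate is below
    the leg length. *)
Lemma valid_words j i T u : valid la j i T u ->
  u \in words (n.+2 + col_height la j) ((col_height la j).+1 - i).
Proof.
move=> /validP[su vu]; rewrite mem_words su eqxx /=; apply/(all_nthP 0) => q qu.
have [cq|] := boolP (candidate la j i u q); last by rewrite /candidate; lia.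
have [D _] := vu q qu cq; have := in_diagram_bound part D.
by rewrite /candidate_col; lia.
Qed.

(** Relates the tabloid and code [x] before the slide to the code [u] after it, [s] being the
    tabloid after it. *)
Definition code_rel j i s (x : {perm 'I_n} * seq nat) u : Prop :=
  exists p, [/\ champion la j i (tab s) u p, x.2 = delete_at p u &
    tab x.1 = unslide (champion_path la j i (tab s) u p) i (i + p) (tab s)].

(** [code_rel] is a bijection from the pairs of a preimage of [s] and a code of it to the codes of
    [s]; [forward_code] and [backward_code] provide the partners. *)
Lemma num_codes_step i j s : 0 < i -> dg (i, j) -> is_std la j i (tab s) ->
  \sum_(t | (slide_perm (i,
    j) t == s) && is_std la j i.+1 (tab t)) num_codes j i.+1 t
  = num_codes j i s.
Proof.
move=> i0 dij /(is_stdP part) st.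
have j0 : 0 < j by case/andP: (in_diagram_gt0 dij).
have ir : i <= col_height la j by move: dij;
  rewrite (in_diagram_height part) // => /andP[].
have injS := tab_inj part (s := s).
set Bd := n.+2 + col_height la j.
pose xs := [seq (t, u) | t <- [seq t <- enum {perm 'I_n} |
       (slide_perm (i, j) t == s) && is_std la j i.+1 (tab t)],
     u <- [seq u <- words Bd ((col_height la j).+1 - i.+1)
       | valid la j i.+1 (tab t) u]].
pose ys := [seq u <- words Bd ((col_height la j).+1 - i) | valid la j i (tab s) u].
have sx : size xs = \sum_(t | (slide_perm (i,
  j) t == s) && is_std la j i.+1 (tab t))
    num_codes j i.+1 t.
  rewrite size_allpairs_dep sumnE big_map big_filter big_enum_cond /=.
  by apply: eq_bigr => t _; rewrite size_filter.
rewrite -sx /num_codes -size_filter -/ys.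
have mx t u : (t, u) \in xs -> [/\ slide la (tab t) (i, j) = tab s,
    std_from la j i.+1 (tab t) & valid la j i.+1 (tab t) u].
  case/allpairsPdep => t' [u' [/=]];
    rewrite !mem_filter => /andP[/andP[/eqP E1 /(is_stdP part) E2] _].
  by move=> /andP[E3 _] [-> ->]; rewrite -slide_permE // E1.
have my u : (u \in ys) = valid la j i (tab s) u.
  rewrite mem_filter; have [v|//] := boolP (valid la j i (tab s) u).
  by rewrite (valid_words v).
have uy : uniq ys by rewrite filter_uniq ?uniq_words.
have ux : uniq xs.
  apply: allpairs_uniq_dep; first by rewrite filter_uniq ?enum_uniq.
    by move=> t _; rewrite filter_uniq ?uniq_words.
  by move=> [t u] [t' u'] _ _ [-> ->].
have inj1 u u' t w : u \in ys -> u' \in ys -> code_rel j i s (t, w) u ->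
    code_rel j i s (t, w) u' -> u = u'.
  rewrite !my => v v' [p [chp Ep Tp]] [p' [chp' Ep' Tp']];
    rewrite /= in Ep Ep' Tp Tp'.
  have [ok di dE dhi _] := backward_code part j0 i0 v chp injS st.
  have [ok' di' dE' dhi' _] := backward_code part j0 i0 v' chp' injS st.
  (* The entry at [(i, j)] of the common preimage marks the end of the slide in [s]. So both
     champions have the same cell, from which the deleted value is recovered. *)
  have A := unslide_start (champion_path la j i (tab s) u p) i (i + p) (tab s).
  have A' := unslide_start (champion_path la j i (tab s) u' p') i (i + p') (tab s).
  rewrite -Tp di in A; rewrite -Tp' di' A in A'.
  have [] := injS _ _ dhi dhi' A'.
  rewrite dE dE' => /addnI Epp Ec; subst p'.
  case: chp chp' => pu cp _ [pu' cp' _].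
  move: cp cp' Ec; rewrite /candidate /candidate_col => c1 c2 c3.
  rewrite -(insert_delete_at 0 pu) -(insert_delete_at 0 pu') -Ep -Ep'.
  by have -> : nth 0 u p = nth 0 u' p by lia.
have inj2 x x' u : code_rel j i s x u -> code_rel j i s x' u -> x = x'.
  case: x x' => t w [t' w'] [p [chp Ep Tp]] [p' [chp' Ep' Tp']].
  have Epp := champion_uniq part j0 chp chp'; rewrite -Epp in Ep' Tp'.
  congr pair; last by rewrite /= in Ep Ep'; rewrite Ep Ep'.
  by apply: (tab_of_inj part); rewrite /= in Tp Tp'; rewrite Tp Tp'.
apply/eqP; rewrite eqn_leq; apply/andP; split.
- apply: (@size_rel_le _ _ _ _ (code_rel j i s)) => // [[t w]|]; last first.
    by move=> x x' y _ _ _; apply: inj2.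
  move=> /mx[Es stt vt].
  have [hi [d [ok di dhi E]]] := slide_path (sumn la) (tab t) dij.
  rewrite -/(slide la (tab t) (i, j)) Es in E.
  have [v ch _ dd] := forward_code part j0 i0 ok di dhi injS st E stt vt.
  exists (insert_at (hi - i) (d hi.+1 - j + (col_height la j - hi)) w);
    first by rewrite my.
  have [ih _] := ok.
  exists (hi - i); split=> //=.
    rewrite delete_insert_at //; case/validP: vt => -> _.
    have : dg (hi, j).
      apply: (in_diagram_sub part dhi); have := path_col_ge ok di (a := hi.+1);
        have := in_diagram_gt0 dhi; lia.
    by rewrite (in_diagram_height part) //; lia.
  by rewrite E subnKC //; apply: unslide_ext.
- apply: (@size_rel_le _ _ _ _ (fun u x => code_rel j i s x u)) =>
  // [u|u u' [t w] h1 h2 _]; last first.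
    exact: inj1.
  rewrite my => v.
  have [su vu] := validP _ _ _ _ _ v.
  have su0 : 0 < size u by rewrite su; lia.
  (* The bottom cell of the column has leg length 0, so its position is always a candidate. *)
  have cl : candidate la j i u (size u).-1 by rewrite /candidate su; lia.
  have [p chp] := champion_exists part j0 (tab s) su0 cl.
  have [ok di dE dhi [stT vT]] := backward_code part j0 i0 v chp injS st.
  set d := champion_path la j i (tab s) u p in ok di dE dhi stT vT.
  have d0 : 0 < d i by rewrite di.
  have [t Et] := unslide_tab part s i0 d0 ok dhi.
  have Es : slide_perm (i, j) t = s.
    apply: (tab_of_inj part); rewrite slide_permE // -Et -di /slide.
    apply: (slide_unslide part j0 i0 injS st) => //; first by rewrite di.
    have := in_diagram_bound part dhi; case/andP: part => _ /eqP ->.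
    have [] := ok; lia.
  rewrite Et in stT vT.
  exists (t, delete_at p u); last by exists p.
  apply/allpairsPdep; exists t, (delete_at p u); split=> //.
    by rewrite mem_filter Es eqxx mem_enum !andbT /=; apply/(is_stdP part).
  by rewrite mem_filter vT (valid_words vT).
Qed.

(** By [foldr] the last cell of [zs] is treated first, as in the sorting procedure. *)
Definition run_slides (zs : seq cell) s : {perm 'I_n} := foldr slide_perm s zs.

Definition num_preimages zs s : nat := #|[set t | run_slides zs t == s]|.

Lemma num_preimages_nil s : num_preimages [::] s = 1.
Proof. by rewrite /num_preimages -[RHS](cards1 s); apply: eq_card => t;
  rewrite !inE. Qed.

Lemma num_preimages_cons z zs s :
  num_preimages (z :: zs) s = \sum_(t | slide_perm z t == s) num_preimages zs t.
Proof.
rewrite /num_preimages -sum1_card (eq_bigl (fun t =>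
  slide_perm z (run_slides zs t) == s)); last first.
  by move=> t; rewrite inE.
rewrite (partition_big (run_slides zs) (fun t => slide_perm z t == s)) //=.
apply: eq_bigr => t /eqP Et; rewrite -sum1_card; apply: eq_bigl => u.
by rewrite inE; case: (run_slides zs u =P t) => [->|_]; rewrite ?Et ?eqxx ?andbF.
Qed.

Lemma num_codes_end j s : num_codes j (col_height la j).+1 s = 1.
Proof.
rewrite /num_codes subnn /= addn0.
by have -> : valid la j (col_height la j).+1 (tab s) [::] by rewrite /valid subnn.
Qed.

(** In row 1 there is no top neighbour, so every reverse path runs left to column [j] and validity
    depends on the shape only. *)
Lemma num_codes_start j s t : 0 < j -> num_codes j 1 s = num_codes j 1 t.
Proof.
move=> j0; apply: eq_count => u.
suff H T T' : valid la j 1 T u -> valid la j 1 T' u by apply/idP/idP; apply: H.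
move=> /validP[su vu]; apply/validP; split=> // q qu cq; have [D _] := vu q qu cq.
split=> //; rewrite crossing_last.
have jc : j <= candidate_col la j 1 u q by rewrite /candidate_col; move: cq;
  rewrite /candidate; lia.
set c := crossing _ _ _ _ _ _ _.
have jc' : j <= c by apply: crossing_ge.
have Dc : dg (1, c) by apply: (in_diagram_sub part D);
  rewrite // (leq_trans j0 jc') crossing_le.
rewrite (@row_exit_skip _ _ _ _ _ _ j) //.
  apply/eqP; rewrite eqn_leq row_exit_le; apply: row_exit_stop => //.
  by rewrite /go_left /region /=; lia.
move=> z hz; rewrite /go_left; apply/andP; split.
  by apply: (region_intro part j0) => //; [apply: (in_diagram_sub part Dc)|]; lia.
by apply/implyP => /region_in_diagram/in_diagram_gt0.
Qed.

(** Induction up the column from the single empty code at its foot, by [num_codes_step]. A tabloid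
    unsorted from [(i, j)] on has no preimage because of [std_slide]. *)
Lemma num_preimages_column j rest K i : 0 < j ->
  (forall s, num_preimages rest s
    = if is_std la j (col_height la j).+1 (tab s) then K else 0) ->
  0 < i <= (col_height la j).+1 ->
  forall s, num_preimages (col_cells la i j ++ rest) s =
    if is_std la j i (tab s) then K * num_codes j i s else 0.
Proof.
move=> j0 H; move E : ((col_height la j).+1 - i) => k.
elim: k i E => [|k IH] i E hi s.
  have -> : i = (col_height la j).+1 by lia.
  by rewrite /col_cells subnn /= H num_codes_end muln1.
have -> : col_cells la i j = (i, j) :: col_cells la i.+1 j.
  by rewrite /col_cells E /= subnS E.
have D : dg (i, j) by rewrite (in_diagram_height part) //; lia.
have i0 : 0 < i by lia.
rewrite /= num_preimages_cons.
rewrite (eq_bigr (fun t =>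
  if is_std la j i.+1 (tab t) then K * num_codes j i.+1 t else 0)); last first.
  by move=> t _; apply: IH; lia.
rewrite -big_mkcondr /= -big_distrr /=.
case: ifP => [st|/negP st]; first by rewrite num_codes_step.
rewrite big_pred0 ?muln0 // => t; apply/negP => /andP[/eqP Es /(is_stdP part) stt].
apply: st; apply/(is_stdP part); rewrite -Es slide_permE //.
by apply: (std_slide part) => //; apply: tab_inj.
Qed.

Lemma num_preimages_cells : exists K, forall s,
  num_preimages (cells la) s = if is_standard la (tab s) then K else 0.
Proof.
suff H k j : 0 < j -> j + k = (head 0 la).+1 -> exists K, forall s,
    num_preimages (flatten [seq col_cells la 1 j' | j' <- iota j k]) s =
    if is_std la j 1 (tab s) then K else 0.
  have [K HK] := H (head 0 la) 1 isT (add1n _).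
  by exists K => s; rewrite (cellsE part) HK (is_standardE part).
elim: k j => [|k IH] j j0 Ej.
  (* To the right of the last column the region is empty and the order condition void. *)
  exists 1 => s; rewrite num_preimages_nil; case: ifP => // /(is_stdP part) [].
  move=> [a b] c' /andP[/= /in_diagramP[a0 _ _ bl] h].
  have := nth_partition part (leq0n a.-1); rewrite nth0; lia.
have [K HK] := IH j.+1 isT (etrans (addSnnS _ _) Ej).
(* The identity serves as reference tabloid, all having equally many codes. *)
exists (K * num_codes j 1 1%g) => s /=.
rewrite (@num_preimages_column _ _ K) //.
  by rewrite (num_codes_start s 1%g).
by move=> t; rewrite HK (std_next_column part).
Qed.

End Counting.

(** * Effect of a slide on the other entries *)

Section SlideEffect.
Variable la : seq nat.
Local Notation dg := (in_diagram la).

Definition weakly_se (p c : cell) : bool := (p.1 <= c.1) && (p.2 <= c.2).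

Lemma weakly_se_adj p q c : adj p q -> weakly_se q c -> weakly_se p c /\ c != p.
Proof.
case: p q c => a b [a' b'] [a'' b''] /orP[]/eqP[-> ->] /andP[/= h1 h2];
by split; [rewrite /weakly_se /=; lia | rewrite xpair_eqE /=; lia].
Qed.

Lemma adj_weakly_se p q : adj p q -> weakly_se p q.
Proof. by case: p q => a b [a' b'] /orP[]/eqP[-> ->]; rewrite /weakly_se /=; lia.
Qed.

Lemma slide_go_off f T p c : ~~ weakly_se p c -> slide_go f la T p c = T c.
Proof.
elim: f T p => // f IH T p nc; rewrite slide_goS.
case: (slide_targetP la T p) => // q pq dq _; case: ifP => // _.
rewrite IH; last by apply: contra nc => /(weakly_se_adj pq)[].
rewrite /swapf; case: eqP => [E|_]; first by move: nc; rewrite E /weakly_se !leqnn.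
by case: eqP => [E|_] //; move: nc; rewrite E adj_weakly_se.
Qed.

Lemma slide_go_inj f T p : inj_on la T -> dg p -> inj_on la (slide_go f la T p).
Proof.
elim: f T p => // f IH T p inj dp; rewrite slide_goS.
case: (slide_targetP la T p) => // q pq dq _; case: ifP => // _.
by apply: IH => //; apply: swapf_inj_on.
Qed.

Lemma slide_go_large f T p c : T p < T c -> slide_go f la T p c = T c.
Proof.
elim: f T p => // f IH T p lt; rewrite slide_goS.
case: (slide_targetP la T p) => // q pq dq _; case: ifP => // lt2.
have Tc : swapf T p q c = T c.
  by rewrite /swapf; case: eqP => [E|_]; [|case: eqP => [E|] //]; move: lt;
    rewrite E; lia.
have Tq : swapf T p q q = T p.
  by rewrite /swapf eqxx; case: eqP => [->|].
by rewrite -Tc; apply: IH; rewrite Tc Tq.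
Qed.

(** An exchanged entry ends up directly behind the sliding one, which never returns; so it moves by
    at most one step, up or left. *)
Lemma slide_go_small f T p c c' : inj_on la T -> dg p -> dg c -> dg c' ->
  T c < T p -> slide_go f la T p c' = T c -> c' = c \/ adj c' c.
Proof.
elim: f T p => [|f IH] T p inj dp dc dc' lt; first by move=> /inj E; left; apply: E.
rewrite slide_goS; case: (slide_targetP la T p) => [_|q pq dq _];
  first by move=> /inj E; left; apply: E.
case: ifP => lt2; last by move=> /inj E; left; apply: E.
have Tp : swapf T p q p = T q by rewrite /swapf eqxx.
have Tq : swapf T p q q = T p by rewrite /swapf eqxx; case: eqP => [->|].
have [E|ne] := eqVneq c q.
  have inj' := swapf_inj_on dp dq inj.
  have injs : inj_on la (slide_go f la (swapf T p q) q) by apply: slide_go_inj.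
  have Ep : slide_go f la (swapf T p q) q p = T q.
    rewrite slide_go_off // /weakly_se; case/orP: pq => /eqP ->;
      rewrite /= ltnn ?andbF //.
  by rewrite E -Ep => /injs ->; [right|..].
have Tc : swapf T p q c = T c.
  rewrite /swapf (negPf ne); case: eqP => // E; move: lt; rewrite E; lia.
by rewrite -Tc; apply: IH => //; [exact: swapf_inj_on | rewrite Tc Tq].
Qed.

Definition swap_vals a (v : nat) : nat :=
  if v == a then a.+1 else if v == a.+1 then a else v.

Lemma swap_vals_lt a u v : u != a -> v != a ->
  (swap_vals a u < swap_vals a v) = (u < v).
Proof. by rewrite /swap_vals; do ![case: eqP]; lia. Qed.

Lemma swap_vals_swapf a T p q : swap_vals a \o swapf T p q
  = swapf (swap_vals a \o T) p q.
Proof.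
by apply: functional_extensionality => c; rewrite /swapf /=; do ![case: ifP].
Qed.

Lemma slide_target_swap a T p : (forall q, adj p q -> dg q -> T q != a) ->
  slide_target la (swap_vals a \o T) p = slide_target la T p.
Proof.
move=> H; rewrite /slide_target; case: ifP => // D1; case: ifP => // D2 /=.
by rewrite swap_vals_lt // H // /adj eqxx ?orbT.
Qed.

(** The value [a] lies out of reach of the slide, so [a] and [a.+1] are never compared with each
    other; all other comparisons survive the exchange of values. *)
Lemma slide_go_swap a f T p c0 : inj_on la T -> dg p -> dg c0 ->
  ~~ weakly_se p c0 -> T c0 = a ->
  slide_go f la (swap_vals a \o T) p = swap_vals a \o slide_go f la T p.
Proof.
elim: f T p => // f IH T p inj dp d0 nc E0; rewrite !slide_goS.
have na q : weakly_se p q -> dg q -> T q != a.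
  by move=> pq dq; apply: contra nc => /eqP; rewrite -E0 => /inj <-.
rewrite slide_target_swap; last by move=> q /adj_weakly_se; apply: na.
case: (slide_targetP la T p) => // q pq dq _ /=.
have pp : weakly_se p p by rewrite /weakly_se !leqnn.
rewrite swap_vals_lt ?na //; last exact: adj_weakly_se.
case: ifP => // _; rewrite -swap_vals_swapf; apply: IH => //.
- exact: swapf_inj_on.
- by apply: contra nc => /(weakly_se_adj pq)[].
- rewrite /swapf; case: eqP => [E|_]; first by rewrite E pp in nc.
  by case: eqP => [E|//]; rewrite E adj_weakly_se in nc.
Qed.

Lemma slide_go_stable f T p : (forall q, adj p q -> dg q -> T p < T q) ->
  slide_go f la T p = T.
Proof.
case: f => // f H; rewrite slide_goS; case: (slide_targetP la T p) => // q pq dq _.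
by rewrite ltnNge ltnW ?H.
Qed.

(* The second case occurs when the values [a] and [a + 1] meet in the slide. *)
Lemma slide_go_swap_start a f T p : 0 < a -> (forall c, ~~ dg c -> T c = 0) ->
  inj_on la T -> dg p -> T p = a ->
  (forall c c', weakly_se p c -> c != p -> dg c -> dg c' -> adj c c' ->
    T c < T c') ->
  slide_go f la (swap_vals a \o T) p = swap_vals a \o slide_go f la T p \/
  slide_go f la (swap_vals a \o T) p = slide_go f la T p.
Proof.
move=> a0; elim: f T p => [|f IH] T p out inj dp Ep st; first by left.
have na q : q != p -> dg q -> T q != a.
  by move=> pq dq; apply: contra pq => /eqP; rewrite -Ep => /inj->.
rewrite !slide_goS slide_target_swap; last first.
  by move=> q pq; apply: na; rewrite eq_sym adj_neq.
case: (slide_targetP la T p) => [_|q pq dq qmin]; first by left.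
have nqp : q != p by rewrite eq_sym adj_neq.
have naq := na q nqp dq.
have Eq : swap_vals a (T q) = if T q == a.+1 then a else T q.
  by rewrite /swap_vals (negPf naq).
have Ea : swap_vals a a = a.+1 by rewrite /swap_vals eqxx.
rewrite /= Ep Ea Eq.
(* In [T] the slide of [a] stops before [a.+1]. With the values exchanged, the first step restores
   [T], and then the slide stops at [q]. *)
have [E1|ne] := eqVneq (T q) a.+1.
  right; rewrite E1 ltnSn; have -> : a.+1 < a = false by lia.
  have -> : swapf (swap_vals a \o T) p q = T.
    apply: functional_extensionality => c; rewrite /swapf /=.
    case: eqP => [->|n1]; first by rewrite E1 /swap_vals; case: eqP;
      rewrite ?eqxx ?Ep //; lia.
    case: eqP => [->|n2]; first by rewrite Ep E1 /swap_vals eqxx.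
    have [dc|/out->] := boolP (dg c); last by rewrite /swap_vals;
      do ![case: eqP]; lia.
    rewrite /swap_vals; case: eqP => [|_]; first by rewrite -Ep => /inj E;
      case: n1; apply: E.
    by case: eqP => //; rewrite -E1 => /inj E; case: n2; apply: E.
  apply: slide_go_stable => q' qq' dq'; apply: st => //; exact: adj_weakly_se.
have -> : (T q < a.+1) = (T q < a) by lia.
case: ifP => lt; last by left.
rewrite -swap_vals_swapf; apply: IH => //.
- move=> c nc; rewrite /swapf; case: eqP => [E|_]; first by rewrite E dp in nc.
  by case: eqP => [E|_]; [rewrite E dq in nc | apply: out].
- exact: swapf_inj_on.
- by rewrite /swapf eqxx (negPf nqp).
- move=> c c' qc nc dc dc' cc'; have [pc ncp] := weakly_se_adj pq qc.
  have [_ nc'p] : weakly_se p c' /\ c' != p.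
    apply: (weakly_se_adj pq); move: cc' qc; case: (c) (c') => x y [x' y'].
    by rewrite /weakly_se; move=> /orP[]/eqP[-> ->] /=; lia.
  have nc'q : c' != q.
    apply/eqP => E; move: cc' qc; rewrite E /weakly_se;
      case: (c) (q) => x y [x' y'].
    by move=> /orP[]/eqP[-> ->] /=; lia.
  by rewrite /swapf (negPf nc) (negPf ncp) (negPf nc'p) (negPf nc'q); apply: st.
Qed.

End SlideEffect.

(** * Stages of the sorting procedure *)

Section Order.
Variables (la : seq nat) (n : nat).
Hypothesis part : is_partition la n.
Local Notation dg := (in_diagram la).
Local Notation tab s := (@tab_of n la s).
Local Notation run := (run_slides la).
Implicit Types s t : {perm 'I_n}.

Definition prec (c c' : cell) : bool := (c.2 < c'.2) || ((c.2 == c'.2) &&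
  (c.1 < c'.1)).

Lemma prec_irr c : prec c c = false.
Proof. by rewrite /prec !ltnn andbF. Qed.

Lemma prec_asym c c' : prec c c' -> prec c' c -> False.
Proof. by rewrite /prec; lia. Qed.

Lemma pairwise_cells : pairwise prec (cells la).
Proof.
rewrite (cellsE part).
elim: (head 0 la) {2}1 => //= m IH j; rewrite pairwise_cat IH andbT; apply/andP;
  split.
  apply/allrelP => -[a b] c /mapP[h _ [_ ->]] /flatten_mapP[j'].
  by rewrite mem_iota => hj /mapP[h' _ ->]; rewrite /prec /=; lia.
rewrite pairwise_map; apply: (@sub_pairwise _ ltn) => [a b /= h|].
  by rewrite /prec /= eqxx h orbT.
by rewrite -sorted_pairwise ?iota_ltn_sorted //; exact: ltn_trans.
Qed.

Lemma prec_nth k m : k < n -> m < n ->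
  prec (nth (0, 0) (cells la) k) (nth (0, 0) (cells la) m) = (k < m).
Proof.
move=> kn mn; have H a b : a < b -> a < n -> b < n ->
    prec (nth (0, 0) (cells la) a) (nth (0, 0) (cells la) b).
  move=> ab an bn; apply: (pairwiseP (0, 0) pairwise_cells) => //.
  by rewrite inE (size_cells part).
  by rewrite inE (size_cells part).
have [lt|gt|->] := ltngtP k m; [exact: H| |exact: prec_irr].
by apply/negP => h; apply: prec_asym h (H _ _ gt mn kn).
Qed.

Lemma mem_drop_cells m c : m < n ->
  (c \in drop m.+1 (cells la)) = dg c && prec (nth (0, 0) (cells la) m) c.
Proof.
move=> mn; apply/idP/idP => [h|/andP[D]].
  rewrite -(mem_cells part) (mem_drop h) /=.
  case/(nthP (0, 0)): h => k; rewrite size_drop (size_cells part) nth_drop => lk <-.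
  by rewrite prec_nth //; lia.
have [k ->] := cell_ix part D; rewrite prec_nth // => mk.
rewrite -(subnKC mk) -nth_drop mem_nth // size_drop (size_cells part).
by have := ltn_ord k; lia.
Qed.

Lemma in_diagram_nth m : m < n -> dg (nth (0, 0) (cells la) m).
Proof. by move=> mn; rewrite -(mem_cells part) mem_nth // (size_cells part). Qed.

Lemma drop_cells m : m < n -> drop m (cells la) = nth (0,
  0) (cells la) m :: drop m.+1 (cells la).
Proof. by move=> mn; rewrite (drop_nth (0, 0)) // (size_cells part). Qed.

Lemma prec_adj c c' : adj c c' -> prec c c'.
Proof. by case: c c' => a b [a' b'] /orP[]/eqP[-> ->]; rewrite /prec /=; lia. Qed.

Lemma run_drop_std m s c c' : m <= n -> c \in drop m (cells la) -> dg c' ->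
  adj c c' ->
  tab (run (drop m (cells la)) s) c < tab (run (drop m (cells la)) s) c'.
Proof.
move=> mn; move Ek : (n - m) => k; elim: k m mn Ek c c' => [|k IH] m mn Ek c c'.
  by rewrite drop_oversize // (size_cells part); lia.
have mn' : m < n by lia.
rewrite (drop_cells mn') /=; have D := in_diagram_nth mn'.
rewrite inE slide_permE //.
case Ez : (nth (0, 0) (cells la) m) => [i j].
rewrite Ez in D; set t := run _ s => h dc' cc'.
have st : std_from la j i.+1 (tab t).
  move=> d d' /andP[dd h1] dd' a; apply: (IH m.+1) => //; first by lia.
  by rewrite mem_drop_cells // Ez dd /prec /=; move: h1; lia.
apply: (std_slide part (tab_inj part (s := t)) D st) => //.
case/orP: h => [/eqP ->|]; first by rewrite /region D /= eqxx leqnn orbT.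
by rewrite mem_drop_cells // Ez => /andP[dc]; rewrite /prec /region dc /=; lia.
Qed.

(** The last cell has no right or bottom neighbour, so its slide does nothing, in accordance with
    T_{z_n} = T. *)
Lemma run_last s : 0 < n -> run (drop n.-1 (cells la)) s = s.
Proof.
move=> n0; have nn : n.-1 < n by lia.
rewrite drop_cells // prednK // drop_oversize ?(size_cells part) //=.
apply: (tab_of_inj part); rewrite slide_permE ?in_diagram_nth //.
apply: slide_go_stable => q /prec_adj h dq.
have := mem_drop_cells q nn;
  rewrite dq h prednK // drop_oversize ?(size_cells part) //.
Qed.

Lemma Tz_run m s : 0 < m <= n ->
  Tz n la (tab s) m = tab (run (drop m.-1 (cells la)) s).
Proof.
move=> hm; rewrite /Tz; have -> : m.-1 = (n - (n - m)).-1 by lia.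
have : n - m < n by lia.
elim: (n - m) => [|d IH] hd; first by rewrite subn0 run_last //; lia.
have dn : (n - d.+1).-1 < n by lia.
rewrite /= (IH (ltnW hd)) /zcell (drop_cells dn).
rewrite /= (slide_permE part); last by apply: in_diagram_nth; lia.
by have -> : (n - d.+1).-1.+1 = (n - d).-1 by lia.
Qed.

Lemma run_off zs s c : all dg zs -> all (fun z => ~~ weakly_se z c) zs ->
  tab (run zs s) c = tab s c.
Proof.
elim: zs => //= z zs IH /andP[dz dzs] /andP[nz nzs].
by rewrite slide_permE // /slide slide_go_off // IH.
Qed.

Lemma prec_not_weakly_se z c : prec c z -> ~~ weakly_se z c.
Proof. by rewrite /prec /weakly_se; lia. Qed.

Lemma all_dg_drop m : all dg (drop m (cells la)).
Proof. by apply/allP => c /mem_drop; rewrite (mem_cells part). Qed.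

Lemma all_nse_drop m : m < n ->
  all (fun z => ~~ weakly_se z (nth (0, 0) (cells la) m)) (drop m.+1 (cells la)).
Proof. by move=> mn; apply/allP => z;
  rewrite mem_drop_cells // => /andP[_ /prec_not_weakly_se]. Qed.

(** Entries are the values of [s] plus one, so the entries [a] and [a.+1] are the values [a.-1] and
    [a]. *)
Definition swap_perm a s : {perm 'I_n} :=
  if insub a.-1 is Some i then if insub a is Some i' then (s * tperm i i')%g else
    s else s.

Lemma swap_permE a s : 0 < a < n -> tab (swap_perm a s) = swap_vals a \o tab s.
Proof.
move=> ha; rewrite /swap_perm; case: insubP => [i _ Ei|]; last by lia.
case: insubP => [i' _ Ei'|]; last by lia.
apply: functional_extensionality => c /=.
have [D|D] := boolP (dg c); last first.
  by rewrite !(tab_out part) //; rewrite /swap_vals; do ![case: eqP]; lia.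
have [k ->] := cell_ix part D; rewrite !(tab_nth part) permM /swap_vals.
have -> : ((s k).+1 == a) = (s k == i) by rewrite -val_eqE /= Ei; lia.
have -> : ((s k).+1 == a.+1) = (s k == i') by rewrite -val_eqE /= Ei'; lia.
have ne : (i' == i) = false by rewrite -val_eqE /= Ei Ei'; lia.
by case: tpermP => [->|->|/eqP/negPf-> /eqP/negPf->];
  rewrite ?eqxx ?ne ?Ei ?Ei' //; lia.
Qed.

Lemma swap_permK a : 0 < a < n -> involutive (swap_perm a).
Proof.
move=> ha s; apply: (tab_of_inj part); rewrite !swap_permE //.
apply: functional_extensionality => c; rewrite /= /swap_vals.
by do ![case: eqP]; lia.
Qed.

Lemma run_swap a zs s c0 : 0 < a < n -> all dg zs ->
  all (fun z => ~~ weakly_se z c0) zs ->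
  dg c0 -> tab s c0 = a -> run zs (swap_perm a s) = swap_perm a (run zs s).
Proof.
move=> ha; elim: zs => //= z zs IH /andP[dz dzs] /andP[nz nzs] d0 E.
rewrite IH //; apply: (tab_of_inj part);
  rewrite slide_permE // !swap_permE // slide_permE //.
apply: (slide_go_swap _ (tab_inj part (s := _)) dz d0 nz).
by rewrite run_off.
Qed.

End Order.
Import Order.TTheory GRing.Theory Num.Theory.

(** * Flow of an entry out of a cell *)

Section Flow.
Variables (la : seq nat) (n : nat).
Hypothesis part : is_partition la n.
Local Notation dg := (in_diagram la).
Local Notation tab s := (@tab_of n la s).
Local Notation run := (run_slides la).
Implicit Types s t : {perm 'I_n}.
Local Notation zc q := (nth (0, 0) (cells la) q).
Local Notation stage q s := (tab (run (drop q (cells la)) s)).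

Lemma count_Nminus x y : count_mem y (Nminus la x) = (dg y && adj y x) :> nat.
Proof.
case: x y => a b [c d]; have [D|nD] /= := boolP (dg (c, d)); last first.
  by apply/eqP; rewrite -leqn0 leqNgt -has_count has_pred1 mem_filter (negPf nD).
case/andP: (in_diagram_gt0 D) => c0 d0.
rewrite count_filter (eq_count (a2 := pred1 (c, d))) => [|y]; last first.
  by rewrite /=; case: eqP => //= ->.
by rewrite /= /adj !xpair_eqE /=; lia.
Qed.

Lemma count_Nplus x y : count_mem y (Nplus la x) = (dg y && adj x y) :> nat.
Proof.
case: x y => a b [c d]; have [D|nD] /= := boolP (dg (c, d)); last first.
  by apply/eqP; rewrite -leqn0 leqNgt -has_count has_pred1 mem_filter (negPf nD).
rewrite count_filter (eq_count (a2 := pred1 (c, d))) => [|y]; last first.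
  by rewrite /=; case: eqP => //= ->.
by rewrite /= /adj !xpair_eqE /=; lia.
Qed.

Lemma sum_pred1 (l : seq cell) c : (\sum_(y <- l) (y == c)%:R
  = (count_mem c l)%:R :> rat)%R.
Proof.
elim: l => [|y l IH]; first by rewrite big_nil.
by rewrite big_cons IH /= natrD.
Qed.

Local Open Scope ring_scope.

(* Cells are numbered from 0 here: [stage q s] is the paper's T_{z_(q+1)}. *)
Definition flow q k x s : rat := (stage q.+1 s x == k)%:R - (stage q s x == k)%:R.

Lemma stage_step q s : (q < n)%N -> stage q s = slide la (stage q.+1 s) (zc q).
Proof. by move=> qn; rewrite (drop_cells part qn) /= (slide_permE part)
  ?(in_diagram_nth part). Qed.

Lemma stage_zc q s : (q < n)%N -> stage q.+1 s (zc q) = tab s (zc q).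
Proof. by move=> qn; apply: (run_off part);
  [exact: (all_dg_drop part) | exact: (all_nse_drop part qn)]. Qed.

(** By [slide_go_small], [k] rests or moves one step up or left, so the change at [x] is one
    departure minus one arrival. *)
Lemma flow_small q k x s : (q < n)%N -> (0 < k)%N -> (k < tab s (zc q))%N -> dg x ->
  flow q k x s =
  \sum_(y <- Nminus la x) ((stage q.+1 s x == k) && (stage q s y == k))%:R
  - \sum_(y <- Nplus la x) ((stage q.+1 s y == k) && (stage q s x == k))%:R.
Proof.
move=> qn k0 kz dx; have Dz := in_diagram_nth part qn.
have kn : (0 < k <= n)%N by rewrite k0 /=; have := tab_range part s Dz; lia.
have [c dc Ec] := tab_surj part (run (drop q.+1 (cells la)) s) kn.
have [c' dc' Ec'] := tab_surj part (run (drop q (cells la)) s) kn.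
have H y : dg y -> (stage q.+1 s y == k) = (y == c).
  by move=> dy; apply/eqP/eqP => [E|->//];
    apply: (tab_inj part (s := run (drop q.+1 (cells la)) s)); rewrite ?E.
have H' y : dg y -> (stage q s y == k) = (y == c').
  by move=> dy; apply/eqP/eqP => [E|->//];
    apply: (tab_inj part (s := run (drop q (cells la)) s)); rewrite ?E.
have dN y : y \in Nminus la x -> dg y by rewrite mem_filter => /andP[].
have dP y : y \in Nplus la x -> dg y by rewrite mem_filter => /andP[].
have -> : \sum_(y <- Nminus la x) ((stage q.+1 s x == k) && (stage q s y == k))%:R =
    (x == c)%:R * (dg c' && adj c' x)%:R :> rat.
  rewrite -count_Nminus -sum_pred1 big_distrr /=; apply: eq_big_seq => y /dN dy.
  by rewrite H // H' // -natrM mulnb.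
have -> : \sum_(y <- Nplus la x) ((stage q.+1 s y == k) && (stage q s x == k))%:R =
    (x == c')%:R * (dg c && adj x c)%:R :> rat.
  rewrite -count_Nplus -sum_pred1 big_distrr /=; apply: eq_big_seq => y /dP dy.
  by rewrite H // H' // -natrM mulnb andbC.
rewrite /flow H // H' // dc dc' /=.
have [] : c' = c \/ adj c' c.
  apply: (slide_go_small (f := sumn la) (tab_inj part (s := run (drop q.+1 (cells
    la)) s)) Dz) => //.
    by rewrite Ec stage_zc.
  by rewrite Ec -Ec' (stage_step s qn).
- by move=> ->; case: eqP => [->|_]; rewrite ?subrr // !mul0r.
- move=> ad; have ne : c' != c by apply/eqP => E; move: (adj_neq ad);
  rewrite E eqxx.
  have [->|n1] := eqVneq x c; first by rewrite ad eq_sym (negPf ne) /= mul0r mulr1.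
  have [->|n2] := eqVneq x c'; last by rewrite !mul0r.
  by rewrite ad mul0r mulr1.
Qed.

Lemma flow_large q k x s : (q < n)%N -> dg x -> (tab s (zc q) < k <= n)%N ->
  flow q k x s = 0.
Proof.
move=> qn dx /andP[kz kn]; have Dz := in_diagram_nth part qn.
have kn' : (0 < k <= n)%N by lia.
have [c dc Ec] := tab_surj part (run (drop q.+1 (cells la)) s) kn'.
have Ec' : stage q s c = k.
  by rewrite (stage_step s qn) /slide slide_go_large // Ec stage_zc.
suff -> : flow q k x s = (x == c)%:R - (x == c)%:R by rewrite subrr.
congr (_%:R - _%:R); apply: congr1; apply/eqP/eqP => [E|->//].
  by apply: (tab_inj part (s := run (drop q.+1 (cells la)) s)); rewrite ?E.
by apply: (tab_inj part (s := run (drop q (cells la)) s)); rewrite ?E.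
Qed.

Lemma sum_entry (v : nat) : (0 < v <= n)%N ->
  \sum_(1 <= l < n.+1) ((v == l)%:R : rat) = 1.
Proof.
move=> hv; rewrite (bigD1_seq v) ?iota_uniq ?mem_index_iota //= eqxx.
rewrite big1_seq ?addr0 // => l /andP[ne _].
by rewrite eq_sym (negPf ne).
Qed.

(** Before and after the slide [x] holds exactly one entry. *)
Lemma flow_total q x s : dg x -> \sum_(1 <= l < n.+1) flow q l x s = 0.
Proof.
move=> dx; rewrite /flow sumrB !sum_entry ?subrr //; exact: tab_range.
Qed.

(** Up to the slide at this cell [a] has not moved, so by [run_swap] the stages differ by the
    exchange of values. In both cases of [slide_go_swap_start] the slide then leaves the position of
    [k < a] unaffected. *)
Lemma flow_swap q a k x s : (q < n)%N -> (0 < a < n)%N -> (k < a)%N -> dg x ->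
  tab s (zc q) = a -> flow q k x (swap_perm a s) = flow q k x s.
Proof.
move=> qn ha ka dx Ez; have Dz := in_diagram_nth part qn.
have E1 : run (drop q.+1 (cells la)) (swap_perm a s)
  = swap_perm a (run (drop q.+1 (cells la)) s).
  by apply: (run_swap part ha _ _ Dz Ez);
    [exact: (all_dg_drop part) | exact: (all_nse_drop part qn)].
have sw v : (swap_vals a v == k) = (v == k).
  by rewrite /swap_vals; do ![case: eqP]; lia.
rewrite /flow !(stage_step _ qn) E1 (swap_permE part) // /= sw.
congr (_ - _%:R); apply: congr1.
have [] := @slide_go_swap_start la a (sumn la) (stage q.+1 s) (zc q).
- by case/andP: ha.
- by move=> c; apply: tab_out.
- exact: tab_inj.
- by [].
- by rewrite stage_zc.
- move=> c c' zcc nc dc dc' cc'; apply: (run_drop_std part) => //.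
  rewrite (mem_drop_cells part) // dc /=; move: zcc nc;
    case: (zc q) (c) => u v [u' v'].
  by rewrite /weakly_se /prec xpair_eqE /=; lia.
- by rewrite /slide => -> /=; rewrite sw.
- by rewrite /slide => ->.
Qed.

Definition exit_flow q a k x : rat := \sum_(s | tab s (zc q) == a) flow q k x s.

(** [swap_perm a] matches the tabloids with [a] in the cell with those having [a.+1] there, at equal
    flow; this is iterated up to [n]. *)
Lemma exit_flow_const q a k x : (q < n)%N -> dg x -> (0 < k < a)%N -> (a <= n)%N ->
  exit_flow q a k x = exit_flow q n k x.
Proof.
move=> qn dx ka an; move Ed : (n - a)%N => d.
elim: d a ka an Ed => [|d IH] a ka an Ed; first by have -> : a = n by lia.
have ha : (0 < a < n)%N by lia.
rewrite -(IH a.+1) /exit_flow; [|lia..].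
rewrite [RHS](reindex_inj (inv_inj (swap_permK part ha))) /=.
rewrite (eq_bigl (fun s => tab (swap_perm a s) (zc q) == a.+1)); last first.
  move=> s; rewrite (swap_permE part) //= /swap_vals; do ![case: eqP]; lia.
apply: eq_bigr => s; rewrite (swap_permE part) //= => Es; rewrite flow_swap //;
  first by lia.
by apply/eqP; move: Es; rewrite /swap_vals; do ![case: eqP]; lia.
Qed.

(** The position of [n] determines [m], so the existential in [eps] becomes a sum with at most one
    nonzero term; [q] stands for [m.-1]. *)
Lemma eps_sum k x y : (eps n la k x y)%:R =
  \sum_(0 <= q < n.-1) \sum_(s | tab s (zc q) == n)
     ((stage q.+1 s x == k) && (stage q s y == k))%:R :> rat.
Proof.
rewrite /eps -sum1_card natr_sum big_mkcond /=.
under [RHS]eq_bigr => q _ do rewrite big_mkcond.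
rewrite exchange_big /=; apply: eq_bigr => s _; rewrite inE.
case: existsP => [[m /andP[/andP[/andP[m0 Em] h1] h2]]|N].
  have mn := ltn_ord m.
  rewrite (Tz_run part) in h1; last by lia.
  rewrite (Tz_run part) in h2; last by lia.
  rewrite (bigD1_seq m.-1) ?iota_uniq ?mem_index_iota //=; last by lia.
  rewrite -/(zcell la m) Em prednK // h1 h2 big1_seq ?addr0 // => q /andP[nq].
  rewrite mem_index_iota => hq; case: eqP => // Eq; exfalso; move/eqP: nq; apply.
  have : zc q == zcell la m.
    apply/eqP/(tab_inj part (s := s)); last by rewrite Eq (eqP Em).
      by apply: (in_diagram_nth part); lia.
    by apply: (@in_diagram_nth _ _ part m.-1); lia.
  by move=> Ez; apply/eqP;
    rewrite -(nth_uniq (0, 0) _ _ (uniq_cells part)) // (size_cells part); lia.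
rewrite big1_seq // => q; rewrite mem_index_iota => hq.
case: eqP => // Eq; case: andP => // -[h1 h2].
have qn : (q.+1 < n)%N by lia.
case: N; exists (Ordinal qn); rewrite /= !(Tz_run part) /=; [|lia..].
by rewrite h1 h2 /zcell /= Eq eqxx.
Qed.

Lemma Delta_sum k x : (0 < k < n)%N -> dg x ->
  Delta n la k x = \sum_(0 <= q < n.-1) exit_flow q n k x.
Proof.
move=> hk dx; rewrite /Delta.
under eq_bigr => y _ do rewrite eps_sum.
under [X in _ - X]eq_bigr => y _ do rewrite eps_sum.
rewrite exchange_big [X in _ - X]exchange_big /= -sumrB.
apply: eq_big_seq => q; rewrite mem_index_iota => hq.
rewrite exchange_big [X in _ - X]exchange_big /= -sumrB.
by apply: eq_bigr => s /eqP Es; apply/esym/flow_small => //; lia.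
Qed.

Lemma sum_flow_perms q k x : (q < n)%N -> (0 < k < n)%N -> dg x ->
  \sum_s flow q k x s = (n - k)%:R * exit_flow q n k x - \sum_(1 <= l < k)
    exit_flow q n l x.
Proof.
move=> qn hk dx; have Dz := in_diagram_nth part qn.
(* Split by the entry [a] of the cell being treated. *)
have -> : \sum_s flow q k x s = \sum_(1 <= a < n.+1) exit_flow q a k x.
  rewrite /exit_flow; under [RHS]eq_bigr => a _ do rewrite big_mkcond.
  rewrite exchange_big /=; apply: eq_bigr => s _.
  rewrite (bigD1_seq (tab s (zc q))) ?iota_uniq ?mem_index_iota ?ltnS ?tab_range
    //= eqxx.
  by rewrite big1_seq ?addr0 // => a /andP[ne _]; rewrite eq_sym (negPf ne).
rewrite (@big_cat_nat _ _ _ k) /=; [|lia|lia].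
(* For [a < k] the entry [k] does not move. *)
rewrite big1_seq ?add0r => [|a]; last first.
  rewrite mem_index_iota => /andP[_ ha]; rewrite /exit_flow big1 // => s /eqP Es.
  by apply: flow_large => //; lia.
rewrite big_ltn; last by lia.
rewrite addrC; congr (_ + _).
  (* The [n - k] entries above [k] contribute equally. *)
  rewrite (eq_big_nat _ _ (F2 := fun=> exit_flow q n k x)); last first.
    by move=> a ha; apply: exit_flow_const => //; lia.
  by rewrite sumr_const_nat subSS mulr_natl.
rewrite (eq_big_nat _ _ (F2 := fun l => exit_flow q k l x)); last first.
  by move=> l hl; rewrite (@exit_flow_const q k) //; lia.
(* For [a = k] the larger entries rest, so by [flow_total] the flow of [k] cancels that of the
   smaller entries. *)
apply/eqP; rewrite -subr_eq0 opprK /exit_flow exchange_big -big_split /=.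
rewrite big1 // => s /eqP Es; rewrite -[RHS](flow_total q s dx).
rewrite [RHS](@big_cat_nat _ _ _ k) /=; [|lia|lia].
rewrite [X in _ = _ + X]big_ltn; last by lia.
rewrite [X in _ = _ + (_ + X)]big1_seq ?addr0 1?addrC // => l.
by rewrite mem_index_iota => /andP[_ hl]; apply: flow_large; lia.
Qed.

Lemma sum_flow_telescope k x s : \sum_(0 <= q < n.-1) flow q k x s =
  (stage n.-1 s x == k)%:R - (stage 0%N s x == k)%:R.
Proof. by rewrite /flow (telescope_sumr (fun q => (stage q s x == k)%:R)). Qed.

(** Exchanging the values [a] and [a.+1] shows that the count is the same for all entries; together
    the counts give [n!]. *)
Lemma card_entry k x : (0 < k <= n)%N -> dg x ->
  \sum_s ((tab s x == k)%:R : rat) = (n.-1)`!%:R.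
Proof.
move=> hk dx; pose cnt k : rat := \sum_s (tab s x == k)%:R.
have step a : (0 < a < n)%N -> cnt a.+1 = cnt a.
  move=> ha; rewrite /cnt (reindex_inj (inv_inj (swap_permK part ha))) /=.
  apply: eq_bigr => s _; rewrite (swap_permE part) //= /swap_vals.
  by congr (_%:R); apply: congr1; do ![case: eqP]; lia.
have const a : (0 < a <= n)%N -> cnt a = cnt 1%N.
  elim: a => // -[|a] IH ha //; rewrite step; last by lia.
  by apply: IH; lia.
have tot : n%:R * cnt 1%N = n`!%:R.
  have <- : \sum_(1 <= l < n.+1) cnt l = n%:R * cnt 1%N.
    rewrite (eq_big_nat _ _ (F2 := fun=> cnt 1%N)) => [|a ha];
      last by apply: const; lia.
    by rewrite sumr_const_nat subSS subn0 mulr_natl.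
  rewrite exchange_big /= (eq_bigr (fun=> 1)) => [|s _]; last first.
    by rewrite sum_entry // tab_range.
  by rewrite sumr_const -[in RHS]card_Sn.
rewrite -/(cnt k) const //; have n0 : (0 < n)%N by lia.
have nz : n%:R != 0 :> rat by rewrite pnatr_eq0; lia.
by apply: (mulfI nz); rewrite tot -natrM -{1}(prednK n0) factS prednK.
Qed.

End Flow.

(** * The recursion and its solution *)

Local Open Scope ring_scope.

(** [K] is the common number of preimages of standard tableaux under the sorting; grouping all
    tabloids by their result gives both identities. *)
Lemma nps_uniform n la : is_partition la n ->
  exists K : nat, n`! = (K * f_la n la)%N /\
    forall k x, \sum_(s : {perm 'I_n}) ((tab_of la (run_slides la (cells la) s) x
      == k)%:R : rat)
      = (K * f_la_at n la k x)%:R.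
Proof.
move=> part; have [K HK] := num_preimages_cells part; exists K.
have E (P : pred {perm 'I_n}) : (\sum_(s | P (run_slides la (cells la) s)) 1 =
    K * #|[set s | is_standard la (tab_of la s) && P s]|)%N.
  rewrite (partition_big (run_slides la (cells la)) P) //=.
  rewrite (eq_bigr (fun t => if is_standard la (tab_of la t) then K else 0%N)).
    rewrite -big_mkcondr /= sum_nat_const mulnC; congr (_ * _)%N.
    by apply: eq_card => s; rewrite !inE andbC.
  move=> t Pt; rewrite -HK /num_preimages -sum1_card; apply: eq_bigl => s.
  by rewrite inE; case: eqP => [->|]; rewrite ?Pt ?andbF.
split=> [|k x].
  have := E xpredT; rewrite sum1_card card_Sn => ->; congr (_ * _)%N.
  by apply: eq_card => s; rewrite !inE andbT.
rewrite -natr_sum -(E (fun s => tab_of la s x == k)); congr (_%:R).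
by rewrite [RHS]big_mkcond /=; apply: eq_bigr => s _; case: eqP.
Qed.

Theorem theorem2 (k n : nat) (la : seq nat) (x : cell) :
  (1 <= k)%N -> (k < n)%N -> is_partition la n -> in_diagram la x ->
  ((n - k)%N%:R * Delta n la k x
     = (n.-1)`!%:R - n`!%:R * (f_la_at n la k x)%:R / (f_la n la)%:R
       + \sum_(1 <= l < k) Delta n la l x)
  /\
  (Delta n la k x
     = n`!%:R / ((n - k)%N%:R * (n - k + 1)%N%:R)
       * (1 - (f_la_at n la k x)%:R / (f_la n la)%:R * (n - k + 1)%N%:R
          - \sum_(1 <= l < k) (f_la_at n la l x)%:R / (f_la n la)%:R)).
Proof.
move=> k1 kn part dx.
have [K [EK Ef]] := nps_uniform part.
have f0 : (f_la n la)%:R != 0 :> rat.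
  by rewrite pnatr_eq0; apply/eqP => E; have := fact_gt0 n; rewrite EK E muln0.
pose g l : rat := (f_la_at n la l x)%:R / (f_la n la)%:R.
have first l : (1 <= l)%N -> (l < n)%N ->
    (n - l)%N%:R * Delta n la l x
     = (n.-1)`!%:R - n`!%:R * g l + \sum_(1 <= i < l) Delta n la i x.
  move=> l1 ln.
  have hl : (0 < l < n)%N by rewrite l1.
  have -> : n`!%:R * g l = (K * f_la_at n la l x)%:R.
    rewrite /g EK !natrM; field; exact: f0.
  rewrite (Delta_sum part hl dx) big_distrr /=.
  rewrite [X in _ = _ + X](eq_big_nat _ _ (F2 := fun i =>
    \sum_(0 <= q < n.-1) exit_flow la n q n i x)); last first.
    by move=> i hi; rewrite (Delta_sum part) //; lia.
  rewrite exchange_big /=; apply/eqP; rewrite -subr_eq -sumrB.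
  (* By [sum_flow_perms] both sides of the recursion combine to the total flow of [l] over all
     tabloids. *)
  rewrite (eq_big_nat _ _ (F2 := fun q =>
    \sum_(s : {perm 'I_n}) flow la q l x s)); last first.
    by move=> q hq; rewrite (sum_flow_perms part) //; lia.
  (* The flow telescopes from stage [n.-1], the unsorted tabloid by [run_last], to stage 0, the
     fully sorted one. *)
  rewrite exchange_big /=; under eq_bigr => s _ do rewrite sum_flow_telescope drop0.
  rewrite sumrB Ef; under eq_bigr =>
    s _ do rewrite (run_last part s (ltnW (leq_ltn_trans l1 ln))).
  by rewrite (card_entry part) //; lia.
(* Partial sums solve the recursion: the sum on the right of [first] turns the factor [n - l.+1]
   into [n - l], which lets the induction proceed. *)
have cumul l : (l < n)%N -> (n - l)%N%:R * \sum_(1 <= i < l.+1) Delta n la i x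
    = \sum_(1 <= i < l.+1) ((n.-1)`!%:R - n`!%:R * g i).
  elim: l => [|l IH] ln; first by rewrite !big_geq ?mulr0.
  rewrite [in LHS]big_nat_recr //= [in RHS]big_nat_recr //= -IH; last by lia.
  rewrite mulrDr first //.
  have -> : (n - l)%N%:R = (n - l.+1)%N%:R + 1 :> rat by rewrite natr1;
    congr (_%:R); lia.
  by ring.
split; first by rewrite -mulrA -/(g k); apply: first.
have k' : k = k.-1.+1 by lia.
have H1 := first k k1 kn.
have H2 : (n - k + 1)%N%:R * \sum_(1 <= i < k) Delta n la i x
    = (k.-1)%:R * (n.-1)`!%:R - n`!%:R * \sum_(1 <= i < k) g i.
  have -> : (n - k + 1 = n - k.-1)%N by lia.
  have := cumul k.-1; rewrite -k' => ->; last by lia.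
  by rewrite sumrB sumr_const_nat -big_distrr /= subn1 mulr_natl.
rewrite -/(g k) -/(\sum_(1 <= l < k) g l).
have nk0 : (n - k)%N%:R != 0 :> rat by rewrite pnatr_eq0; lia.
have nk1 : (n - k + 1)%N%:R != 0 :> rat by rewrite pnatr_eq0; lia.
(* Splits [n] as [(n - k + 1) + (k - 1)], so that the multiples of [(n - 1)!] from [H1] and [H2] add
   up to [n!]. *)
have En : n`!%:R = ((n - k + 1)%N%:R + (k.-1)%:R) * (n.-1)`!%:R :> rat.
  rewrite -natrD -natrM; congr (_%:R); have -> : (n - k + 1 + k.-1 = n)%N by lia.
  by case: (n) kn.
apply: (mulfI nk0); apply: (mulfI nk1); rewrite H1 mulrDr H2.
set G := \sum_(1 <= i < k) g i in H2 *.
transitivity (n`!%:R * (1 - g k * (n - k + 1)%N%:R - G)); last first.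
  move: nk0 nk1; move: ((n - k)%N%:R : rat) ((n - k + 1)%N%:R : rat) => a b a0 b0.
  by field; rewrite a0 b0.
by rewrite En; ring.
Qed.
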